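(* Let $\rho,\nu\in P_+^\infty(\mathbb{R}^d)$ be such that the integrals below are well-defined. Then the linearized Wasserstein divergence satisfies $$D^{\dot H^{-1}}(\rho\mid\nu)=\frac12\int_{\mathbb{R}^d}\int_{\mathbb{R}^d}\Phi(x-y)\,\big(\rho(x)-\nu(x)\big)\big(\rho(y)-\nu(y)\big)\,dx\,dy,$$ where $\Phi$ is the fundamental solution of $-\Delta\Phi=\delta_0$ on $\mathbb{R}^d$.
   Context: $P_+^\infty(\mathbb{R}^d)$ is the set of smooth, strictly positive probability densities on $\mathbb{R}^d$ (with respect to Lebesgue measure). $\Phi$ is the standard fundamental solution of $-\Delta$: $\Phi(x)=-\tfrac12|x|$ for $d=1$, the logarithmic potential $-\tfrac1{2\pi}\ln\|x\|$ for $d=2$, and the Newtonian/Coulomb potential for $d\ge3$. The linearized Wasserstein ($\dot H^{-1}$) geometry has the ($\rho$-independent) Onsager operator $\phi_\rho^{\dot H^{-1}}([f])=-\Delta f$, where $[f]$ is the class of $f$ modulo constants, with inverse given by $(\phi^{\dot H^{-1}}_\rho)^{-1}(a)=[\Phi*a]$ for densities $a$ of total integral zero. The associated metric is $g^{\dot H^{-1}}(a,b)=\int_{\mathbb{R}^d}a\,(\Phi*b)\,dx$. A dual geodesic is a curve $\gamma\colon[0,1]\to P_+^\infty(\mathbb{R}^d)$ with $\dot\gamma(t)=\phi^{\dot H^{-1}}_{\gamma(t)}\big((\phi^{\dot H^{-1}}_{\gamma(0)})^{-1}(\dot\gamma(0))\big)$, and $$D^{\dot H^{-1}}(\rho\mid\nu)=\inf\Big\{\int_0^1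 t\,g^{\dot H^{-1}}(\dot\gamma(t),\dot\gamma(t))\,dt:\ \gamma\text{ is a dual geodesic},\ \gamma(0)=\rho,\ \gamma(1)=\nu\Big\}.$$ *)

(* Defs.v *)
From HB Require Import structures.
From mathcomp Require Import all_boot all_order all_algebra.
From mathcomp Require Import all_classical all_reals all_analysis.

Set Implicit Arguments.
Unset Strict Implicit.
Unset Printing Implicit Defensive.

Import Order.TTheory GRing.Theory Num.Theory.
Import numFieldNormedType.Exports.

Local Open Scope classical_set_scope.
Local Open Scope ring_scope.

(* 'rV[T]_n carries the product sigma-algebra, generated by the coordinates; for
   T := R this is the Borel sigma-algebra of R^n. *)
Definition measure_rV_display : measure_display -> measure_display.
Proof. exact. Qed.

Section measurable_rV.
Context {dT : measure_display} {T : measurableType dT} (n : nat).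

Definition rV_coord (i : 'I_n) (x : 'rV[T]_n) : T := x ord0 i.

Let rV_set0 : g_sigma_preimage rV_coord set0.
Proof. exact: sigma_algebra0. Qed.

Let rV_setC A : g_sigma_preimage rV_coord A -> g_sigma_preimage rV_coord (~` A).
Proof. exact: sigma_algebraC. Qed.

Let rV_bigcup (F : (set 'rV[T]_n)^nat) :
  (forall i, g_sigma_preimage rV_coord (F i)) ->
  g_sigma_preimage rV_coord (\bigcup_i (F i)).
Proof. exact: sigma_algebra_bigcup. Qed.

HB.instance Definition _ := @isMeasurable.Build (measure_rV_display dT)
  'rV[T]_n (g_sigma_preimage rV_coord) rV_set0 rV_setC rV_bigcup.

End measurable_rV.

Lemma measurable_rV_coord d (T : measurableType d) n (i : 'I_n) :
  measurable_fun [set: 'rV[T]_n] (fun x : 'rV[T]_n => x ord0 i).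
Proof.
move=> _ Y mY; rewrite setTI; apply: sub_sigma_algebra => /=.
rewrite -bigcup_seq/=; exists i => /=; first by rewrite mem_index_enum.
by exists Y => //; rewrite setTI.
Qed.

Lemma measurable_fun_rV d1 d2 (T1 : measurableType d1) (T2 : measurableType d2)
    n (f : T1 -> 'rV[T2]_n) :
  (forall i, measurable_fun [set: T1] (fun x => f x ord0 i)) ->
  measurable_fun [set: T1] f.
Proof.
move=> mf _ A mA; rewrite setTI.
suff : measurable `<=` [set B : set 'rV[T2]_n | measurable (f @^-1` B)] by exact.
apply: smallest_sub.
  split => /=.
  - by rewrite preimage_set0; exact: measurable0.
  - by move=> B mB; rewrite setTD preimage_setC; exact: measurableC.
  - by move=> F mF; rewrite preimage_bigcup; exact: bigcup_measurable.
move=> B; rewrite -bigcup_seq/= => -[i _ [C mC <-]].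
by have := mf i measurableT C mC; rewrite !setTI.
Qed.

Section lebesgue_rV.
Context {R : realType}.
Local Open Scope ereal_scope.

Section step.
Context (n : nat) (mu : {sigma_finite_measure set 'rV[R]_n -> \bar R}).

Definition rV_cons (p : measurableTypeR R * 'rV[R]_n) : 'rV[R]_n.+1 :=
  row_mx (p.1%:M : 'rV_1) p.2.

Let rV_uncons (x : 'rV[R]_n.+1) : measurableTypeR R * 'rV[R]_n :=
  (x ord0 ord0, \row_i x ord0 (lift ord0 i)).

Lemma rV_cons0 p : rV_cons p ord0 ord0 = p.1.
Proof.
have e : (ord0 : 'I_n.+1) = lshift n (ord0 : 'I_1) by exact/val_inj.
by rewrite e (row_mxEl (p.1%:M : 'rV[R]_1) p.2) mxE eqxx mulr1n.
Qed.

Lemma rV_cons_lift p i : rV_cons p ord0 (lift ord0 i) = p.2 ord0 i.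
Proof.
have e : lift ord0 i = rshift 1 i :> 'I_n.+1 by exact/val_inj.
by rewrite e (row_mxEr (p.1%:M : 'rV[R]_1) p.2).
Qed.

Let rV_consK : cancel rV_cons rV_uncons.
Proof.
move=> [a v]; rewrite /rV_uncons rV_cons0; congr pair.
by apply/rowP => i; rewrite mxE rV_cons_lift.
Qed.

Lemma measurable_rV_cons : measurable_fun setT rV_cons.
Proof.
apply: measurable_fun_rV => i; have [j ->|->] := unliftP ord0 i.
  under eq_fun do rewrite rV_cons_lift.
  apply: (@measurableT_comp _ _ _ _ _ _ (fun x : 'rV[R]_n => x ord0 j)) => //.
  exact: measurable_rV_coord.
by under eq_fun do rewrite rV_cons0; exact: measurable_fst.
Qed.

Let measurable_rV_uncons : measurable_fun setT rV_uncons.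
Proof.
apply: measurable_fun_pair; first exact: measurable_rV_coord.
apply: measurable_fun_rV => i; under eq_fun do rewrite mxE.
exact: measurable_rV_coord.
Qed.

Definition lebesgue_rV_step : set 'rV[R]_n.+1 -> \bar R :=
  pushforward (@lebesgue_measure R \x mu) rV_cons.

Let step0 : lebesgue_rV_step set0 = 0.
Proof. by rewrite /lebesgue_rV_step /pushforward preimage_set0 measure0. Qed.

Let step_ge0 A : 0 <= lebesgue_rV_step A.
Proof. by rewrite /lebesgue_rV_step /pushforward measure_ge0. Qed.

Let step_sigma_additive : semi_sigma_additive lebesgue_rV_step.
Proof.
move=> F mF tF mUF; rewrite /lebesgue_rV_step /pushforward preimage_bigcup.
apply: measure_semi_sigma_additive.
- by move=> k; rewrite -[X in measurable X]setTI; exact: measurable_rV_cons.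
- apply/trivIsetP => /= i j _ _ ij; rewrite -preimage_setI.
  by move/trivIsetP : tF => /(_ _ _ _ _ ij) ->//; rewrite preimage_set0.
- rewrite -preimage_bigcup -[X in measurable X]setTI.
  exact: measurable_rV_cons.
Qed.

HB.instance Definition _ := isMeasure.Build _ _ _ lebesgue_rV_step
  step0 step_ge0 step_sigma_additive.

Let step_sigma_finite : sigma_finite setT lebesgue_rV_step.
Proof.
have /sigma_finiteP[F [TF ndF Foo]] := sigma_finiteT (@lebesgue_measure R).
have /sigma_finiteP[G [TG ndG Goo]] := sigma_finiteT mu.
exists (fun k => rV_uncons @^-1` (F k `*` G k)).
  apply/esym; rewrite -subTset => x _.
  have [i _ Fi] : (\bigcup_i F i) (rV_uncons x).1 by rewrite -TF.
  have [j _ Gj] : (\bigcup_i G i) (rV_uncons x).2 by rewrite -TG.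
  exists (maxn i j) => //; split.
    by move: Fi; exact/subsetPset/ndF/leq_maxl.
  by move: Gj; exact/subsetPset/ndG/leq_maxr.
move=> k; have [mF Fk] := Foo k; have [mG Gk] := Goo k; split.
  rewrite -[X in measurable X]setTI.
  by apply: measurable_rV_uncons => //; exact: measurableX.
rewrite /lebesgue_rV_step /pushforward -comp_preimage.
rewrite (_ : _ \o _ = id); last by apply/funext => p /=; rewrite rV_consK.
by rewrite preimage_id product_measure1E// lte_mul_pinfty// ge0_fin_numE.
Qed.

HB.instance Definition _ := Measure_isSigmaFinite.Build _ _ _ lebesgue_rV_step
  step_sigma_finite.

End step.

(* The n-fold product of the one-dimensional Lebesgue measure; 'rV_0 is a
   point, of mass 1. *)
Fixpoint lebesgue_rV (n : nat) : {sigma_finite_measure set 'rV[R]_n -> \bar R} :=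
  if n is m.+1 then lebesgue_rV_step (lebesgue_rV m) else \d_(0%R : 'rV[R]_0).

End lebesgue_rV.

Section linearized_wasserstein.
Context {R : realType} (d : nat).
Local Notation E := 'rV[R]_d.
Local Notation leb := (@lebesgue_rV R d).
Implicit Types (f a b rho nu : E -> R) (gam dgam : R -> E -> R).

Definition partial (i : 'I_d) f : E -> R := 'D_(delta_mx ord0 i) f.

Fixpoint Ck (k : nat) f : Prop :=
  continuous f /\
  if k is k'.+1 then
    forall i, (forall x, derivable f x (delta_mx ord0 i)) /\ Ck k' (partial i f)
  else True.

Definition smooth f := forall k, Ck k f.

Definition laplacian f : E -> R := fun x => \sum_i partial i (partial i f) x.

Definition enorm (x : E) : R := Num.sqrt (\sum_i x ord0 i ^+ 2).

Definition unit_ball_volume : R := fine (leb [set x | enorm x <= 1]).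

(* For d >= 3 this is |x|^(2-d) / (d (d-2) omega_d), where omega_d is the volume
   of the unit ball, so that d omega_d is the area of the unit sphere. The value
   at x = 0 is irrelevant, and so is the formula for d = 0. *)
Definition Phi (x : E) : R :=
  match d with
  | 1 => - (enorm x / 2)
  | 2 => - ((2 * pi)^-1 * ln (enorm x))
  | _ => (d%:R * (d - 2)%:R * unit_ball_volume)^-1 * enorm x ^- (d - 2)
  end.

(* Phi * a; meaningful where Phi_conv_defined holds *)
Definition Phi_conv a : E -> R := fun x => \int[leb]_y (Phi (x - y) * a y).

Definition Phi_conv_defined a :=
  forall x, leb.-integrable setT (fun y => (Phi (x - y) * a y)%:E).

Definition pos_smooth_density f :=
  [/\ smooth f, forall x, 0 < f x & (\int[leb]_x (f x)%:E = 1)%E].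

Definition tangent a :=
  [/\ smooth a, leb.-integrable setT (EFin \o a) & (\int[leb]_x (a x)%:E = 0)%E].

(* A class [f] modulo constants, as the set of its representatives *)
Definition mod_const f : set (E -> R) :=
  [set h | exists c : R, forall x, h x = f x + c].

(* phi_rho([f]), on a C^2 representative f of the class; it depends neither on
   the representative nor on rho. *)
Definition onsager rho f : E -> R := fun x => - laplacian f x.

(* phi_rho^-1(a) = [Phi * a] *)
Definition onsager_inv rho a : set (E -> R) := mod_const (Phi_conv a).

Definition metric rho a b : \bar R := (\int[leb]_x (a x * Phi_conv b x)%:E)%E.

(* dgam t is the pointwise time derivative of gam on [0,1], one-sided at the
   endpoints. *)
Definition velocity gam dgam := forall t, t \in `[0, 1] -> forall x : E,
  h^-1 * (gam (t + h) x - gam t x)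
    @[h --> within [set h : R | t + h \in `[0, 1]] 0^'] --> dgam t x.

(* f is the class phi_(gam 0)^-1 (dgam 0), which the equation of dual geodesics
   transports by phi_(gam t). *)
Definition dual_geodesic gam dgam :=
  [/\ forall t, t \in `[0, 1] -> pos_smooth_density (gam t),
      velocity gam dgam,
      forall t, t \in `[0, 1] -> tangent (dgam t) &
      Phi_conv_defined (dgam 0) /\
      exists2 f, onsager_inv (gam 0) (dgam 0) f /\ Ck 2 f &
        forall t, t \in `[0, 1] -> forall x, dgam t x = onsager (gam t) f x].

Definition divergence rho nu : \bar R := ereal_inf [set e : \bar R |
  exists gam dgam, [/\ dual_geodesic gam dgam, gam 0 = rho, gam 1 = nu &
    e = (\int[lebesgue_measure]_(t in `[0%R, 1%R])
           (t%:E * metric (gam t) (dgam t) (dgam t)))%E]].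

Definition energy_density rho nu (x y : E) : R :=
  Phi (x - y) * (rho x - nu x) * (rho y - nu y).

(* Existence, as Lebesgue integrals, of both integrals in
   int (int energy_density x y dx) dy. By Fubini's theorem this follows from
   integrability of energy_density for the product measure. *)
Definition energy_defined rho nu :=
  {ae leb, forall y,
    leb.-integrable setT (fun x => (energy_density rho nu x y)%:E)} /\
  leb.-integrable setT (fun y => \int[leb]_x (energy_density rho nu x y)%:E)%E.

End linearized_wasserstein.

(* Main.v *)
Require Import Defs.
From mathcomp Require Import all_boot all_order all_algebra.
From mathcomp Require Import all_classical all_reals all_analysis.
From mathcomp Require Import measurable_realfun.
From mathcomp Require Import ring lra.

(** The Onsager operator of the linearized Wasserstein geometry does not depend on the base
    point, so the velocity of a dual geodesic is constant in time: a dual geodesic from rho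
    to nu is the segment rho + t a with a = nu - rho (dual_geodesic_velocity). Its action is
    the integral of t g(a, a) over [0, 1], that is g(a, a) / 2, and g(a, a) is the double
    integral of the statement because Phi is even (metric_energy). Hence the set whose
    infimum defines the divergence has at most one element.

    What remains is that this set is not empty, that is, that the segment from rho to nu is a
    dual geodesic (dual_geodesic_exists). This is potential theory: Phi * a has to converge
    everywhere, to be of class C^2, and to satisfy - Delta (Phi * a) = a at every point, for
    a smooth and integrable a whose derivatives are not controlled at infinity.

    For r > 0 replace Phi inside the ball of radius r by the second-order Taylor polynomial,
    in the variable |x|^2, of its radial profile at r^2. This splits Phi into a C^2 kernel
    G_r with bounded derivatives (cap) and a kernel K_r supported in the ball (sing) which is
    at most C r |x|^(1-n) off the origin, hence has an integral of order r (integral_sing).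
    The derivatives of G_r * a may be taken on G_r, where only the integrability of a
    matters; those of K_r * a may be taken on a, where only the values of a near the point
    matter. Therefore Phi * a is of class C^2 and
      - Delta (Phi * a) = (- Delta G_r) * a - K_r * (Delta a).
    Now - Delta G_r is a nonnegative function supported in the ball of radius r (an inverted
    paraboloid, by cap_laplacian) with integral 1 (integral_mollifier), so the right-hand side
    tends to a as r tends to 0; the left-hand side does not depend on r (poisson). All
    the integrals over balls come from the layer-cake formula and the scaling of the volume of
    balls (layer_cake).

    Finally, the energy hypothesis provides absolute convergence of Phi * a at one point, and
    that propagates to all points (energy_Phi_conv_defined, Phi_conv_defined_from). *)

Set Implicit Arguments.
Unset Strict Implicit.
Unset Printing Implicit Defensive.

Import Order.TTheory GRing.Theory Num.Theory.
Import numFieldNormedType.Exports.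

Local Open Scope classical_set_scope.
Local Open Scope ring_scope.

(** * Borel sets of the space of row vectors *)

Section borel_rV.
Context {R : realType}.

Lemma mxnorm_ltP (n : nat) (v : 'rV[R]_n) (e : R) : 0 < e ->
  `|v| < e <-> forall i, `|v ord0 i| < e.
Proof.
move=> e0; rewrite [`|v|]mx_normrE; split.
  by move=> /bigmax_ltP[_ h] i; exact: (h (ord0, i)).
move=> h; apply/bigmax_ltP; split => // -[a i] _ /=; by rewrite ord1.
Qed.

Lemma mxnorm_leP (n : nat) (v : 'rV[R]_n) (e : R) : 0 <= e ->
  `|v| <= e <-> forall i, `|v ord0 i| <= e.
Proof.
move=> e0; rewrite [`|v|]mx_normrE; split.
  by move=> /bigmax_leP[_ h] i; exact: (h (ord0, i)).
move=> h; apply/bigmax_leP; split => // -[a i] _ /=; by rewrite ord1.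
Qed.

Lemma coord_le_norm (n : nat) (v : 'rV[R]_n) i : `|v ord0 i| <= `|v|.
Proof.
rewrite leNgt; apply/negP => h.
have /(mxnorm_ltP _ (le_lt_trans (normr_ge0 _) h)) /(_ i) := h.
by rewrite ltxx.
Qed.

(** The sigma-algebra of R^n is generated by coordinates, not by open sets; the two
    agree because every open set is a countable union of cubes with rational centres. *)
Lemma open_measurable_rV (n : nat) (O : set 'rV[R]_n) : open O -> measurable O.
Proof.
move=> oO.
pose box (p : 'rV[rat]_n * nat) : set 'rV[R]_n :=
  [set x | forall i, `|x ord0 i - ratr (p.1 ord0 i)| < p.2.+1%:R^-1].
have mbox p : measurable (box p).
  rewrite (_ : box p = \big[setI/setT]_(i < n)
      [set x : 'rV[R]_n | `|x ord0 i - ratr (p.1 ord0 i)| < p.2.+1%:R^-1]).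
    apply: bigsetI_measurable => i _; rewrite -[X in measurable X]setTI.
    have mg : measurable_fun setT (fun x : 'rV[R]_n => `|x ord0 i - ratr (p.1 ord0 i)|).
      apply: measurableT_comp => //.
      by apply: measurable_funB => //; exact: (@measurable_rV_coord _ (measurableTypeR R)).
    have := mg measurableT `]-oo, p.2.+1%:R^-1[%classic (measurable_itv _).
    by rewrite !setTI; congr (measurable _); apply/seteqP; split => x /=; rewrite in_itv.
  apply/seteqP; split => x /=.
    by move=> h; rewrite -bigcap_seq => i _; exact: h.
  by rewrite -bigcap_seq => h i; apply: h => //=; rewrite mem_index_enum.
have -> : O = \bigcup_(p : 'rV[rat]_n * nat) (if `[< box p `<=` O >] then box p else set0).
  apply/seteqP; split => x; last first.
    by move=> [p _]; case: asboolP => // h; exact: h.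
  move=> Ox; have /nbhs_ballP[e /= e0 eO] := open_nbhs_nbhs (conj oO Ox).
  pose k := Num.truncn (2 / e).
  have k2 : k.+1%:R^-1 < e / 2.
    rewrite -[X in _ < X]invrK ltf_pV2 ?posrE ?invr_gt0 ?divr_gt0// invf_div.
    exact: truncnS_gt.
  have k0 : 0 < k.+1%:R^-1 :> R by rewrite invr_gt0.
  have /choice[q qP] : forall i, exists q : rat, `|x ord0 i - ratr q| < k.+1%:R^-1.
    move=> i; have [|q] := @rat_in_itvoo R (x ord0 i - k.+1%:R^-1) (x ord0 i).
      by rewrite ltrBlDr ltrDl.
    rewrite in_itv/= => /andP[q1 q2]; exists q.
    by rewrite gtr0_norm ?subr_gt0// ltrBlDl -ltrBlDr.
  exists (\row_i q i, k) => //; case: asboolP => h.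
    by move=> i; rewrite mxE; exact: qP.
  exfalso; apply: h => y yb; apply: eO.
  rewrite -ball_normE/=; apply/mxnorm_ltP => // i; rewrite !mxE.
  have := yb i; rewrite /= !mxE => yq; have xq := qP i.
  rewrite (le_lt_trans (ler_distD (ratr (q i)) _ _))//.
  rewrite (splitr e) ltrD// (lt_trans _ k2)//.
  by rewrite distrC.
apply: countable_bigcupT_measurable; first exact: countableP.
by move=> p; case: asboolP.
Qed.

Lemma continuous_measurable_rV (n : nat) (f : 'rV[R]_n -> R) :
  continuous f -> measurable_fun setT f.
Proof.
move=> /continuousP cf; apply: (measurability _ (RGenOpens.measurableE R)).
move=> _ [_ [a [b ->] <-]]; rewrite setTI; apply: open_measurable_rV.
exact/cf/interval_open.
Qed.

Lemma measurable_le_rV (n : nat) (f : 'rV[R]_n -> R) (c : R) :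
  continuous f -> measurable [set x | f x <= c].
Proof.
move=> cf.
have := continuous_measurable_rV cf measurableT (measurable_itv `]-oo, c]).
by rewrite setTI; congr (measurable _); apply/seteqP; split => x /=; rewrite in_itv.
Qed.

End borel_rV.

(** * Affine changes of variables *)

Section lebesgue_rV_facts.
Context {R : realType}.
Local Open Scope ereal_scope.
Local Notation leb n := (@lebesgue_rV R n).

Lemma ge0_integral_rVS (n : nat) (f : 'rV[R]_n.+1 -> \bar R) :
  measurable_fun setT f -> (forall x, 0 <= f x) ->
  \int[leb n.+1]_x f x =
  \int[lebesgue_measure]_t \int[leb n]_v f (rV_cons (t, v)).
Proof.
move=> mf f0.
transitivity (\int[pushforward (lebesgue_measure \x leb n) (@rV_cons R n)]_x f x) => //.
rewrite ge0_integral_pushforward//; last exact: measurable_rV_cons.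
rewrite preimage_setT fubini_tonelli1//.
  by apply: measurableT_comp => //; exact: measurable_rV_cons.
by move=> x; exact: f0.
Qed.

(** The scaled pushforward agrees with Lebesgue measure on half-open intervals, and
    these determine a measure on the line. *)
Lemma lebesgue_measure_affine (b c : R) (A : set R) : (c != 0)%R -> measurable A ->
  `|c|%:E * lebesgue_measure ((fun t => b + c * t)%R @^-1` A) = lebesgue_measure A.
Proof.
move=> c0 mA.
have ac : (0 < `|c|)%R by rewrite normr_gt0.
pose phi (t : measurableTypeR R) : measurableTypeR R := (b + c * t)%R.
have mphi : measurable_fun setT phi.
  by apply: measurable_funD => //; exact: measurable_funM.
pose mu' : {measure set (measurableTypeR R) -> \bar R} :=
  mscale (NngNum (ltW ac)) (pushforward lebesgue_measure phi).
rewrite -[LHS]/(mu' mphi A); apply/esym/lebesgue_measure_unique => // _ [[u v]] _ <-.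
have -> X : mu' mphi X = `|c|%:E * lebesgue_measure (phi @^-1` X) by [].
rewrite [LHS]lebesgue_measure_itv/= lte_fin.
have [uv|vu] := ltP u v; last first.
  rewrite (_ : _ @^-1` _ = set0) ?measure0 ?mule0//.
  apply/seteqP; split => t //=; rewrite in_itv/= => /andP[ut tv].
  by have := lt_le_trans ut tv; rewrite ltNge vu.
have [cp|cn] := ltP 0%R c.
  have -> : phi @^-1` `]u, v] = `]((u - b) / c)%R, ((v - b) / c)%R]%classic.
    apply/seteqP; split => t /=; rewrite !in_itv/= ltr_pdivrMr// ler_pdivlMr//;
      rewrite /phi => /andP[? ?]; apply/andP; split; lra.
  rewrite lebesgue_measure_itv/= lte_fin ltr_pM2r ?invr_gt0// ltrD2r uv.
  by rewrite gtr0_norm// -!EFinD -EFinM; congr (_%:E); field.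
have {}cn : (c < 0)%R by rewrite lt_neqAle c0.
have -> : phi @^-1` `]u, v] = `[((v - b) / c)%R, ((u - b) / c)%R[%classic.
  apply/seteqP; split => t /=; rewrite !in_itv/= ltr_ndivlMr// ler_ndivrMr//;
    rewrite /phi => /andP[? ?]; apply/andP; split; lra.
rewrite lebesgue_measure_itv/= lte_fin ltr_nM2r ?invr_lt0// ltrD2r uv.
by rewrite ltr0_norm// -!EFinD -EFinM; congr (_%:E); field.
Qed.

Lemma ge0_integral_affine1 (b c : R) (f : R -> \bar R) : (c != 0)%R ->
  measurable_fun setT f -> (forall x, 0 <= f x) ->
  `|c|%:E * \int[lebesgue_measure]_t f (b + c * t)%R = \int[lebesgue_measure]_t f t.
Proof.
move=> c0 mf f0.
have ac : (0 < `|c|)%R by rewrite normr_gt0.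
pose phi (t : measurableTypeR R) : measurableTypeR R := (b + c * t)%R.
have mphi : measurable_fun setT phi.
  by apply: measurable_funD => //; exact: measurable_funM.
rewrite -[X in _ * X]/(\int[lebesgue_measure]_(t in phi @^-1` setT) (f \o phi) t).
rewrite -ge0_integral_pushforward//.
rewrite -(ge0_integral_mscale _ _ (NngNum (ltW ac)))//.
by apply: eq_measure_integral => A mA _; exact: lebesgue_measure_affine.
Qed.

Lemma measurable_rV_affine (n : nat) (b : 'rV[R]_n) (c : R) :
  measurable_fun setT (fun x : 'rV[measurableTypeR R]_n => b + c *: x : 'rV[R]_n)%R.
Proof.
apply: (@measurable_fun_rV _ _ _ (measurableTypeR R)) => i.
under eq_fun do rewrite !mxE.
apply: measurable_funD => //; apply: measurable_funM => //.
exact: measurable_rV_coord.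
Qed.

(** Induction on the dimension with Tonelli: every coordinate contributes a factor
    |c|. The case c = -1 gives the reflections used for convolutions, b = 0 gives scaling. *)
Lemma ge0_integral_affine (n : nat) (b : 'rV[R]_n) (c : R) (f : 'rV[R]_n -> \bar R) :
  (c != 0)%R -> measurable_fun setT f -> (forall x, 0 <= f x) ->
  (`|c| ^+ n)%:E * \int[leb n]_x f (b + c *: x)%R = \int[leb n]_x f x.
Proof.
move=> c0; elim: n b f => [|n IH] b f mf f0.
  rewrite expr0 mul1e; apply: eq_integral => x _; congr f.
  by apply/rowP => -[].
rewrite !ge0_integral_rVS//; last first.
  by apply: measurableT_comp => //; exact: measurable_rV_affine.
pose b' : 'rV[R]_n := (\row_i b ord0 (lift ord0 i))%R.
have fE t v : f (b + c *: rV_cons (t, v))%R =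
    f (rV_cons (b ord0 ord0 + c * t, b' + c *: v))%R.
  congr f; apply/rowP => i; rewrite [LHS]mxE [X in (_ + X)%R]mxE.
  have [j ->|->] := unliftP ord0 i; first by rewrite !rV_cons_lift/= !mxE.
  by rewrite !rV_cons0.
have mfc : measurable_fun setT (fun p => f (rV_cons p)).
  by apply: measurableT_comp => //; exact: measurable_rV_cons.
have mft t : measurable_fun setT (fun v => f (rV_cons (t, v))).
  exact: measurableT_comp mfc _.
have mI : measurable_fun setT
    (fun t : measurableTypeR R => \int[leb n]_v f (rV_cons (t, v))).
  exact: (measurable_fun_fubini_tonelli_F (fun p => f (rV_cons p))).
rewrite -(@ge0_integral_affine1 (b ord0 ord0) c
  (fun t => \int[leb n]_v f (rV_cons (t, v))))//; last first.
  by move=> t; exact: integral_ge0.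
have mI' : measurable_fun setT
    (fun t : measurableTypeR R => \int[leb n]_v f (b + c *: rV_cons (t, v))%R).
  apply: (measurable_fun_fubini_tonelli_F (fun p => f (b + c *: rV_cons p)%R)) => //.
  apply: measurableT_comp => //.
  apply: (measurableT_comp (measurable_rV_affine b c)).
  exact: measurable_rV_cons.
have cn0 : (0 <= (`|c| ^+ n)%:E :> \bar R) by rewrite lee_fin exprn_ge0.
rewrite exprSr EFinM -muleA muleCA -[in LHS]ge0_integralZl//; last first.
  by move=> t _; exact: integral_ge0.
congr (_ * _); apply: eq_integral => t _.
under eq_integral do rewrite fE.
by rewrite (IH b' (fun v => f (rV_cons (b ord0 ord0 + c * t, v))%R)).
Qed.

Lemma lebesgue_rV0E (f : 'rV[R]_0 -> \bar R) : \int[@lebesgue_rV R 0]_x f x = f 0%R.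
Proof.
rewrite /= integral_dirac//; first by rewrite diracE in_setT mul1e.
move=> _ Y _; rewrite setTI.
have [f0Y|f0Y] := pselect (Y (f 0%R)).
  rewrite (_ : _ @^-1` _ = setT); first exact: measurableT.
  apply/seteqP; split => // x _; rewrite /preimage/=.
  by rewrite (_ : x = 0%R)//; apply/rowP => -[].
rewrite (_ : _ @^-1` _ = set0); first exact: measurable0.
apply/seteqP; split => // x; rewrite /preimage/= => h; apply: f0Y.
by rewrite (_ : 0%R = x)//; apply/rowP => -[].
Qed.

Lemma measurable_rV_box (n : nat) (c : R) : (0 <= c)%R ->
  measurable [set x : 'rV[R]_n | forall i, `|x ord0 i| <= c]%R.
Proof.
move=> c0.
have := @measurable_le_rV R n (fun x => `|x|)%R c (@norm_continuous _ _).
by congr (measurable _); apply/seteqP; split => x /= /mxnorm_leP; exact.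
Qed.

Lemma lebesgue_rV_box (n : nat) (c : R) : (0 <= c)%R ->
  @lebesgue_rV R n [set x | forall i, `|x ord0 i| <= c]%R = ((2 * c) ^+ n)%:E.
Proof.
move=> c0; elim: n => [|n IH].
  rewrite expr0 /= diracE mem_set//=; first by case.
have -> : @lebesgue_rV R n.+1 = lebesgue_rV_step (@lebesgue_rV R n) :> (set _ -> _) by [].
rewrite /lebesgue_rV_step /pushforward.
rewrite (_ : _ @^-1` _ = `[(- c)%R, c] `*` [set x : 'rV[R]_n | forall i, `|x ord0 i| <= c]%R).
  rewrite product_measure1E//=.
    rewrite [X in _ * X]IH lebesgue_measure_itv/= lte_fin.
    have [cc|cc] := ltP (- c)%R c.
      by rewrite -EFinB -EFinM exprS; congr (_ * _)%:E; ring.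
    by rewrite (_ : c = 0)%R ?mulr0 ?exprS ?mul0r ?mul0e//; lra.
  exact: measurable_rV_box.
apply/seteqP; split => [[t v]|[t v]] /=.
  rewrite in_itv/= -ler_norml => h; split; first by have := h ord0; rewrite rV_cons0.
  by move=> i; have := h (lift ord0 i); rewrite rV_cons_lift.
rewrite in_itv/= -ler_norml => -[h1 h2] i.
by have [j ->|->] := unliftP ord0 i; rewrite ?rV_cons_lift ?rV_cons0//=.
Qed.

End lebesgue_rV_facts.

(** * Euclidean balls *)

Section balls.
Context {R : realType}.

Definition sqn (n : nat) (x : 'rV[R]_n) : R := \sum_i x ord0 i ^+ 2.

Lemma sqn_ge0 n (x : 'rV[R]_n) : 0 <= sqn x.
Proof. by apply: sumr_ge0 => i _; exact: sqr_ge0. Qed.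

Lemma enorm_ge0 n (x : 'rV[R]_n) : 0 <= enorm x.
Proof. exact: sqrtr_ge0. Qed.

Lemma sqr_enorm n (x : 'rV[R]_n) : enorm x ^+ 2 = sqn x.
Proof. by rewrite sqr_sqrtr// sqn_ge0. Qed.

Lemma enormZ n (c : R) (x : 'rV[R]_n) : enorm (c *: x) = `|c| * enorm x.
Proof.
rewrite /enorm -sqrtr_sqr -sqrtrM ?sqr_ge0// mulr_sumr; congr Num.sqrt.
by apply: eq_bigr => i _; rewrite mxE exprMn.
Qed.

Lemma enormN n (x : 'rV[R]_n) : enorm (- x) = enorm x.
Proof. by rewrite -scaleN1r enormZ normrN1 mul1r. Qed.

Lemma coord_le_enorm n (x : 'rV[R]_n) i : `|x ord0 i| <= enorm x.
Proof.
rewrite -sqrtr_sqr ler_wsqrtr// (bigD1 i)//= lerDl.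
by apply: sumr_ge0 => j _; exact: sqr_ge0.
Qed.

Lemma norm_le_enorm n (x : 'rV[R]_n) : `|x| <= enorm x.
Proof. by apply/mxnorm_leP => [|i]; rewrite ?enorm_ge0 ?coord_le_enorm. Qed.

Lemma enorm_le_box n (x : 'rV[R]_n) (c : R) : 0 <= c ->
  (forall i, `|x ord0 i| <= c) -> enorm x <= n%:R * c.
Proof.
move=> c0 h; rewrite -[leRHS]ger0_norm ?mulr_ge0// -sqrtr_sqr ler_wsqrtr//.
apply: (@le_trans _ _ (\sum_(i < n) c ^+ 2)).
  by apply: ler_sum => i _; rewrite -real_normK ?num_real// lerXn2r ?nnegrE.
rewrite sumr_const card_ord exprMn -[leLHS]mulr_natl ler_wpM2r ?sqr_ge0//.
by rewrite -natrX ler_nat; case: n {h x} => // n; rewrite leq_pmulr.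
Qed.

Lemma cvg_sumr (T I : Type) (F : set_system T) {FF : Filter F} (r : seq I)
    (f : I -> T -> R) (l : I -> R) : (forall i, f i x @[x --> F] --> l i) ->
  \sum_(i <- r) f i x @[x --> F] --> \sum_(i <- r) l i.
Proof.
move=> fl; elim: r => [|i r IH].
  by rewrite big_nil; under eq_cvg do rewrite big_nil; exact: cvg_cst.
by rewrite big_cons; under eq_cvg do rewrite big_cons; exact: cvgD.
Qed.

Lemma sqn_continuous n : continuous (@sqn n).
Proof.
move=> x; apply: (@cvg_sumr _ _ _ (nbhs_filter x)) => i; rewrite expr2.
under eq_cvg do rewrite expr2.
by apply: cvgM; exact: coord_continuous.
Qed.

Lemma enorm_continuous n : continuous (@enorm R n).
Proof.
move=> x; rewrite /enorm; apply: (@continuous_comp _ _ _ (@sqn n) Num.sqrt).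
  exact: sqn_continuous.
exact: sqrt_continuous.
Qed.

Lemma measurable_enorm n : measurable_fun setT (@enorm R n).
Proof. exact: (continuous_measurable_rV (@enorm_continuous n)). Qed.

Local Notation leb n := (@lebesgue_rV R n).

(** Finite or not, the volume of a ball is r^n times that of the unit ball; finiteness
    comes afterwards from the enclosing cube. *)
Lemma lebesgue_ball_le n (r : R) : 0 < r ->
  leb n [set x | enorm x <= r] = ((r ^+ n)%:E * leb n [set x | enorm x <= 1]%R)%E.
Proof.
move=> r0.
have mB c : measurable [set x : 'rV[R]_n | enorm x <= c].
  exact: (measurable_le_rV _ (@enorm_continuous n)).
rewrite -[LHS]mul1e -[in LHS](setIT [set x | enorm x <= r]) -integral_indic//.
rewrite -[in RHS](setIT [set x | enorm x <= 1]) -integral_indic// mul1e.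
rewrite -(@ge0_integral_affine _ _ 0 r (fun x => (\1_[set x | enorm x <= r] x)%:E)).
- rewrite (gtr0_norm r0); congr (_ * _)%E; apply: eq_integral => x _; rewrite !indicE.
  have -> : (x \in [set x0 : 'rV[R]_n | enorm x0 <= 1]) =
      (0 + r *: x \in [set x0 : 'rV[R]_n | enorm x0 <= r]) => //.
  rewrite add0r; apply/idP/idP; rewrite !inE/= enormZ gtr0_norm//;
  by rewrite -ler_pdivlMl// mulVf ?gt_eqF.
- by rewrite gt_eqF.
- by apply/measurable_EFinP; exact: measurable_indic.
- by move=> x; rewrite lee_fin.
Qed.

Lemma unit_ball_volumeE n :
  leb n [set x | enorm x <= 1] = (@unit_ball_volume R n)%:E.
Proof.
rewrite /unit_ball_volume fineK// ge0_fin_numE//.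
rewrite (@le_lt_trans _ _ (leb n [set x | forall i, `|x ord0 i| <= 1]))//.
  apply: le_measure; rewrite ?inE.
  - exact: (measurable_le_rV _ (@enorm_continuous n)).
  - exact: measurable_rV_box.
  - by move=> x /= x1 i; rewrite (le_trans (coord_le_enorm _ _)).
by rewrite lebesgue_rV_box// ltry.
Qed.

Lemma unit_ball_volume_gt0 n : 0 < @unit_ball_volume R n.
Proof.
rewrite -lte_fin -unit_ball_volumeE.
rewrite (@lt_le_trans _ _ (leb n [set x | forall i, `|x ord0 i| <= n.+1%:R^-1]))//.
  by rewrite lebesgue_rV_box// lte_fin exprn_gt0// mulr_gt0.
apply: le_measure; rewrite ?inE.
- exact: measurable_rV_box.
- exact: (measurable_le_rV _ (@enorm_continuous n)).
- move=> x /= h; rewrite (le_trans (enorm_le_box _ h))//.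
  by rewrite ler_pdivrMr// mul1r ler_nat.
Qed.

Lemma lebesgue_ball n (r : R) : 0 < r ->
  leb n [set x | enorm x <= r] = (r ^+ n * unit_ball_volume n)%:E.
Proof. by move=> r0; rewrite lebesgue_ball_le// unit_ball_volumeE. Qed.

End balls.

(** * The unit ball in dimensions one and two *)

Section low_dim.
Context {R : realType}.

Lemma unit_ball_volume1 : @unit_ball_volume R 1 = 2.
Proof.
have := @lebesgue_rV_box R 1 1 ler01.
rewrite /unit_ball_volume => h.
rewrite (_ : [set x | _] = [set x : 'rV[R]_1 | forall i, `|x ord0 i| <= 1]).
  by rewrite h/= mulr1 expr1.
apply/seteqP; split => x /=.
  by move=> x1 i; rewrite (le_trans (coord_le_enorm _ _)).
by move=> /(_ ord0); rewrite /enorm big_ord1 sqrtr_sqr.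
Qed.

Local Notation mu := (@lebesgue_measure R).

Lemma is_derive_continuous (f : R -> R) (x df : R) :
  is_derive x 1 f df -> {for x, continuous f}.
Proof.
by move=> d; apply/differentiable_continuous/derivable1_diffP; exact: ex_derive.
Qed.

Lemma FTC2_is_derive (f F : R -> R) (a b : R) : a < b ->
  (forall x, a <= x <= b -> is_derive x 1 F (f x)) ->
  {within `[a, b], continuous f} ->
  (\int[mu]_(x in `[a, b]) (f x)%:E = (F b)%:E - (F a)%:E)%E.
Proof.
move=> ab dF cf.
have cF x : a <= x <= b -> {for x, continuous F}.
  by move=> /dF d; exact: is_derive_continuous d.
apply: continuous_FTC2 => //.
- split.
  + move=> x; rewrite in_itv/= => /andP[ax xb].
    by have d : is_derive x 1 F (f x) by apply: dF; rewrite !ltW.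
  + by apply: cvg_at_right_filter; apply: cF; rewrite lexx ltW.
  + by apply: cvg_at_left_filter; apply: cF; rewrite lexx ltW.
- move=> x; rewrite in_itv/= => /andP[ax xb]; rewrite derive1E.
  have d : is_derive x 1 F (f x) by apply: dF; rewrite !ltW.
  by rewrite derive_val.
Qed.

(** The substitution t = sin u turns the integrand into 2 cos^2 u, whose primitive is
    u + sin u cos u. *)
Lemma integral_half_disc :
  (\int[mu]_(t in `[(-1 : R)%R, 1%R]) (2 * Num.sqrt (1 - t ^+ 2))%R%:E = (pi : R)%:E)%E.
Proof.
have p0 : (0 : R) < pi / 2 by rewrite divr_gt0 ?pi_gt0.
have dsin : (@sin R)^`()%classic = cos.
  by apply/funext => x; rewrite derive1E derive_val.
have cG : continuous (fun t : R => 2 * Num.sqrt (1 - t ^+ 2)).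
  move=> t; apply: cvgM; first exact: cvg_cst.
  apply: (@continuous_comp _ _ _ (fun t : R => 1 - t ^+ 2) Num.sqrt).
    by apply: cvgB; [exact: cvg_cst|exact: exprn_continuous].
  exact: sqrt_continuous.
have subst := @integration_by_substitution_increasing R (@sin R)
  (fun t => 2 * Num.sqrt (1 - t ^+ 2)) (- (pi / 2)) (pi / 2).
rewrite sinN sin_pihalf dsin in subst.
rewrite subst.
- rewrite (@eq_integral _ _ _ mu _ (fun t => (2 * cos t ^+ 2)%:E)).
    transitivity ((pi / 2 + sin (pi / 2) * cos (pi / 2))%:E -
        (- (pi / 2) + sin (- (pi / 2)) * cos (- (pi / 2)))%:E : \bar R)%E.
      apply: (@FTC2_is_derive _ (fun t => t + sin t * cos t)).
      + lra.
      + move=> x _; apply: is_derive_eq.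
        by rewrite /GRing.scale/=; have := cos2Dsin2 x; lra.
      + apply: continuous_subspaceT => x; apply: cvgM; first exact: cvg_cst.
        apply: (@continuous_comp _ _ _ (@cos R) (fun t => t ^+ 2)).
          exact: continuous_cos.
        exact: exprn_continuous.
    by rewrite cosN cos_pihalf !mulr0 !addr0 -EFinB; congr (_%:E); lra.
  move=> t; rewrite inE/= in_itv/= => t12; congr (_%:E).
  rewrite -[LHS]/(2 * Num.sqrt (1 - sin t ^+ 2) * cos t).
  rewrite -cos2sin2 sqrtr_sqr ger0_norm ?cos_ge0_pihalf//.
  by rewrite -mulrA -expr2.
- lra.
- by move=> x y xI yI xy; rewrite ltr_sin.
- by move=> x _; exact: continuous_cos.
- by apply/cvg_ex; eexists; apply: cvg_at_right_filter; exact: continuous_cos.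
- by apply/cvg_ex; eexists; apply: cvg_at_left_filter; exact: continuous_cos.
- split.
  + by move=> x _; exact: derivable_sin.
  + by apply: cvg_at_right_filter; exact: continuous_sin.
  + by apply: cvg_at_left_filter; exact: continuous_sin.
- exact: continuous_subspaceT.
Qed.

(** The two-dimensional fundamental solution is normalized with pi rather than with the
    volume of the unit ball, so the area of the disc has to be known. Its vertical sections
    are segments of half-length sqrt(1 - t^2). *)
Lemma unit_ball_volume2 : @unit_ball_volume R 2 = pi.
Proof.
have mB c : measurable [set x : 'rV[R]_2 | enorm x <= c].
  exact: (measurable_le_rV _ (@enorm_continuous R 2)).
rewrite /unit_ball_volume -[RHS]/(fine pi%:E) -integral_half_disc; congr fine.
rewrite -[in LHS](setIT [set x | enorm x <= 1]) -integral_indic//.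
rewrite ge0_integral_rVS//; last first.
  by apply/measurable_EFinP; exact: measurable_indic.
rewrite [RHS]integral_mkcond; apply: eq_integral => t _.
rewrite patchE; case: ifPn => [|].
  rewrite inE/= in_itv/= => /andP[t1 t2].
  have t0 : 0 <= 1 - t ^+ 2 by nra.
  have mb := @measurable_rV_box R 1 _ (sqrtr_ge0 (1 - t ^+ 2)).
  transitivity (@lebesgue_rV R 1
      [set x | forall i, `|x ord0 i| <= Num.sqrt (1 - t ^+ 2)]%R); last first.
    by rewrite lebesgue_rV_box ?sqrtr_ge0// expr1.
  rewrite -[X in _ = @lebesgue_rV R 1 X]setIT -integral_indic//.
  apply: eq_integral => v _; rewrite !indicE.
  have -> : (rV_cons (t, v) \in [set x : 'rV[R]_2 | enorm x <= 1]) =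
      (v \in [set x : 'rV[R]_1 | forall i, `|x ord0 i| <= Num.sqrt (1 - t ^+ 2)]) => //.
  apply/idP/idP; rewrite !inE/=.
    rewrite /enorm big_ord_recl big_ord1 rV_cons0 rV_cons_lift/= => h i.
    have -> : i = ord0 by exact: ord1.
    rewrite -sqrtr_sqr ler_wsqrtr// lerBrDl.
    by rewrite -(@ler_sqrt _ _ 1)// sqrtr1.
  move=> /(_ ord0) h.
  rewrite /enorm big_ord_recl big_ord1 rV_cons0 rV_cons_lift/=.
  rewrite -[leRHS]sqrtr1 ler_wsqrtr// -lerBrDl -ler_sqrt// sqrtr_sqr//.
move=> tn; rewrite integral0_eq// => v _; rewrite indicE.
case: (boolP (_ \in _)) => //; rewrite inE/= => h; exfalso; move: tn => /negP; apply.
have := coord_le_enorm (rV_cons (t, v)) ord0; rewrite rV_cons0/= => h'.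
by rewrite inE/= in_itv/= -ler_norml (le_trans h').
Qed.

End low_dim.

(** * Integrals of radial functions *)

Section layer_cake.
Context {R : realType}.
Local Notation mu := (@lebesgue_measure R).
Local Notation leb n := (@lebesgue_rV R n).

Let layer n : set ('rV[R]_n * measurableTypeR R) := [set p | enorm p.1 <= p.2 <= 1].

Let measurable_layer_set n : measurable (@layer n).
Proof.
have -> : @layer n =
    [set p | enorm p.1 - p.2 \in `]-oo, 0]] `&` [set p | p.2 \in `]-oo, 1]].
  apply/seteqP; split => -[x t] /=; rewrite /layer/= !in_itv/= subr_le0.
    by move=> /andP[].
  by move=> [h1 h2]; rewrite h1 h2.
apply: measurableI.
  have mg : measurable_fun setT (fun p : 'rV[R]_n * measurableTypeR R => enorm p.1 - p.2).
    apply: measurable_funB; last exact: measurable_snd.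
    by apply: (measurableT_comp (@measurable_enorm R n)); exact: measurable_fst.
  by have := mg measurableT _ (measurable_itv `]-oo, 0]); rewrite setTI.
have mg : measurable_fun setT (fun p : 'rV[R]_n * measurableTypeR R => p.2).
  exact: measurable_snd.
by have := mg measurableT _ (measurable_itv `]-oo, 1]); rewrite setTI.
Qed.

Let layerw n (w : R -> R) (p : 'rV[R]_n * measurableTypeR R) : \bar R :=
  (w p.2 * \1_(@layer n) p)%:E.

Let measurable_layerw n w : measurable_fun setT w -> measurable_fun setT (@layerw n w).
Proof.
move=> mw.
apply/measurable_EFinP; apply: measurable_funM.
  by apply: (measurableT_comp mw); exact: measurable_snd.
by apply: measurable_indic; exact: measurable_layer_set.
Qed.

Let integral_layerE n (w : R -> R) (x : 'rV[R]_n) :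
  (\int[mu]_(t in `[enorm x, 1%R]) (w t)%:E = \int[mu]_t layerw w (x, t))%E.
Proof.
rewrite integral_mkcond; apply: eq_integral => t _.
rewrite /layerw /= indicE patchE.
have -> : (t \in `[enorm x, 1%R]%classic) = ((x, t) \in @layer n).
  by apply/idP/idP; rewrite !inE/= ?in_itv.
by case: (_ \in @layer n); rewrite /= ?mulr1 ?mulr0.
Qed.

Let layerw_ge0 n (w : R -> R) (p : 'rV[R]_n * measurableTypeR R) :
  (forall t, 0 <= w t) -> (0 <= layerw w p)%E.
Proof. by move=> w0; rewrite lee_fin mulr_ge0. Qed.

Lemma measurable_layer n (w : R -> R) : measurable_fun setT w -> (forall t, 0 <= w t) ->
  measurable_fun setT (fun x : 'rV[R]_n => \int[mu]_(t in `[enorm x, 1%R]) (w t)%:E)%E.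
Proof.
move=> mw w0; under eq_fun do rewrite integral_layerE.
apply: (measurable_fun_fubini_tonelli_F (layerw w)).
  exact: measurable_layerw.
by move=> p; exact: layerw_ge0.
Qed.

(** Tonelli on the set of pairs (x, t) with |x| <= t <= 1, whose section at t is a ball
    of volume t^n omega_n. It reduces integrals of radial functions over the unit ball to
    integrals over [0, 1]. *)
Lemma layer_cake n (w : R -> R) : measurable_fun setT w ->
  (forall t, 0 <= w t) -> w 0 = 0 ->
  (\int[leb n]_x \int[mu]_(t in `[enorm x, 1%R]) (w t)%:E =
   \int[mu]_(t in `[0%R, 1%R]) (w t * (t ^+ n * unit_ball_volume n))%R%:E)%E.
Proof.
move=> mw w0 w00.
have mf := @measurable_layerw n w mw.
have f0 p := @layerw_ge0 n w p w0.
under eq_integral do rewrite integral_layerE.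
rewrite fubini_tonelli//= [RHS]integral_mkcond; apply: eq_integral => t _.
rewrite patchE.
have [t01|t01] := boolP (t \in `[0%R, 1%R]%classic); last first.
  rewrite integral0_eq// => x _; rewrite /layerw indicE.
  case: (boolP (_ \in @layer n)) => [|_]; last by rewrite mulr0.
  rewrite inE/= => /andP[h1 h2]; exfalso; move/negP : t01; apply.
  by rewrite inE/= in_itv/= h2 andbT (le_trans (enorm_ge0 x)).
move: t01; rewrite inE/= in_itv/= => /andP[t0 t1].
move: t0; rewrite le_eqVlt => /orP[/eqP <-|t0].
  rewrite w00 mul0r integral0_eq// => x _; rewrite /layerw/= w00 mul0r//.
rewrite [X in _ = X]EFinM -lebesgue_ball//.
have mB : measurable [set x : 'rV[R]_n | enorm x <= t].
  exact: (measurable_le_rV _ (@enorm_continuous R n)).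
rewrite -[X in _ = (_ * leb n X)%E]setIT -integral_indic//.
have m1 : measurable_fun setT (fun x : 'rV[R]_n => (\1_[set y | enorm y <= t] x : R)%:E).
  by apply/measurable_EFinP; exact: measurable_indic.
have w0' : (0 <= (w t)%:E)%E by rewrite lee_fin.
rewrite -ge0_integralZl//.
apply: eq_integral => x _; rewrite /layerw -EFinM/= !indicE.
have -> // : ((x, t) \in @layer n) = (x \in [set x : 'rV[R]_n | enorm x <= t]).
by apply/idP/idP; rewrite !inE /layer/= t1 ?andbT.
Qed.

(** Layer cake with w t = 2 t, because 1 - |x|^2 is the integral of 2 t over [|x|, 1]. *)
Lemma integral_paraboloid n : (0 < n)%N ->
  (\int[leb n]_x (Num.max 0 (1 - enorm x ^+ 2))%:E =
   (2 * unit_ball_volume n / (n%:R + 2))%R%:E)%E.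
Proof.
move=> n0.
pose w (t : R) := Num.max 0 (2 * t).
have mw : measurable_fun setT w.
  by apply: measurable_maxr => //; exact: measurable_funM.
have w0 t : 0 <= w t by rewrite le_max lexx.
have wE t : 0 <= t -> w t = 2 * t by move=> t0; apply/max_idPr; lra.
transitivity (\int[leb n]_x \int[mu]_(t in `[enorm x, 1%R]) (w t)%:E)%E.
  apply: eq_integral => x _; have x0 := enorm_ge0 x.
  have [x1|x1|x1] := ltgtP (enorm x) 1.
  - transitivity (\int[mu]_(t in `[enorm x, 1%R]) (2 * t)%:E)%E; last first.
      apply: eq_integral => t; rewrite inE/= in_itv/= => /andP[t0 _].
      by rewrite wE// (le_trans x0).
    transitivity ((1 ^+ 2)%:E - (enorm x ^+ 2)%:E : \bar R)%E.
      rewrite -EFinB expr1n; congr (_%:E); apply/max_idPr.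
      by rewrite subr_ge0 expr_le1 // ltW.
    apply/esym; apply: (@FTC2_is_derive _ _ (fun t => t ^+ 2)) => //.
      by move=> t _; apply: is_derive_eq; rewrite /GRing.scale/=; lra.
    apply: continuous_subspaceT => t; exact: mulrl_continuous.
  - rewrite set_itv_ge; last by rewrite bnd_simp -ltNge.
    rewrite integral_set0; congr (_%:E); apply/max_idPl.
    by rewrite subr_le0 expr_ge1// ltW.
  - by rewrite x1 set_itv1 integral_set1 expr1n subrr maxxx.
rewrite layer_cake//; last by rewrite wE// mulr0.
have -> : (2 * unit_ball_volume n / (n%:R + 2))%R%:E =
    ((2 * unit_ball_volume n / n.+2%:R * 1 ^+ n.+2)%:E -
     (2 * unit_ball_volume n / n.+2%:R * 0 ^+ n.+2)%:E :> \bar R)%E.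
  rewrite -EFinB expr1n expr0n mulr0 subr0 mulr1.
  by congr ((_ / _)%:E); rewrite -(addn2 n) natrD.
transitivity (\int[mu]_(t in `[0%R, 1%R]) (2 * unit_ball_volume n * t ^+ n.+1)%R%:E)%E.
  apply: eq_integral => t; rewrite inE/= in_itv/= => /andP[t0 t1].
  by rewrite wE// exprS; congr (_%:E); ring.
set c := 2 * unit_ball_volume n / n.+2%:R.
have dF (t : R) : 0 <= t <= 1 ->
    is_derive t 1 (fun t => c * t ^+ n.+2) (2 * unit_ball_volume n * t ^+ n.+1).
  move=> _; have -> : 2 * unit_ball_volume n * t ^+ n.+1 = c * (n.+2%:R * t ^+ n.+1).
    by rewrite /c mulrA divfK// pnatr_eq0.
  have d : is_derive t 1 ((@idfun R) ^+ n.+2) ((n.+2%:R * t ^+ n.+1) *: 1).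
    exact: is_deriveX.
  have -> : (fun t : R => c * t ^+ n.+2) = c *: ((@idfun R) ^+ n.+2).
    by apply/funext => u; rewrite /= exprfctE.
  rewrite -[X in is_derive _ _ _ (c * X)]mulr1.
  exact: is_deriveZ.
have cf : {within `[0, 1], continuous (fun t : R => 2 * unit_ball_volume n * t ^+ n.+1)}.
  apply: continuous_subspaceT => t; apply: cvgM; first exact: cvg_cst.
  exact: exprn_continuous.
exact: (FTC2_is_derive ltr01 dF cf).
Qed.

(** Layer cake with w t = (n - 1) t^(-n): on the ball, |x|^(1-n) is 1 plus the integral
    of w over [|x|, 1], and w t * t^n is bounded. *)
Lemma integral_weak_singularity n : (0 < n)%N ->
  (\int[leb n]_(x in [set x | enorm x <= 1]%R) (enorm x `^ (1 - n%:R))%:E < +oo)%E.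
Proof.
move=> n0; have n1 : 1 <= n%:R :> R by rewrite ler1n.
have mB : measurable [set x : 'rV[R]_n | enorm x <= 1].
  exact: (measurable_le_rV _ (@enorm_continuous R n)).
pose w (t : R) := (n%:R - 1) * t `^ (- n%:R).
have mw : measurable_fun setT w by apply: measurable_funM => //; exact: measurable_powR.
have w0 t : 0 <= w t by rewrite mulr_ge0 ?powR_ge0// subr_ge0.
have w00 : w 0 = 0 by rewrite /w powR0 ?mulr0// oppr_eq0; lra.
pose h (x : 'rV[R]_n) : \bar R := (\int[mu]_(t in `[enorm x, 1%R]) (w t)%:E)%E.
have h0 x : (0 <= h x)%E by apply: integral_ge0 => t _; rewrite lee_fin.
have mp : measurable_fun setT (fun x : 'rV[R]_n => (enorm x `^ (1 - n%:R))%:E).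
  apply/measurable_EFinP; apply: (measurableT_comp (measurable_powR _)).
  exact: measurable_enorm.
have key (x : 'rV[R]_n) : enorm x <= 1 -> ((enorm x `^ (1 - n%:R))%:E <= 1 + h x)%E.
  move=> x1; have := enorm_ge0 x; rewrite le_eqVlt => /orP[/eqP <-|x0].
    (* At the origin the power is 1 for n = 1 and 0 otherwise. *)
    rewrite (le_trans _ (leeDl _ (h0 _)))// lee_fin.
    have [->|np] := eqVneq (1 - n%:R : R) 0; first by rewrite powRr0.
    by rewrite powR0.
  move: x1; rewrite le_eqVlt => /orP[/eqP ->|x1].
    by rewrite powR1 leeDl.
  rewrite /h.
  have -> : (\int[mu]_(t in `[enorm x, 1%R]) (w t)%:E =
     (- (1 `^ (1 - n%:R)))%:E - (- (enorm x `^ (1 - n%:R)))%:E)%E.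
    apply: (@FTC2_is_derive _ _ (fun t => - (t `^ (1 - n%:R)))) => //.
      move=> t /andP[t0 t1]; have {}t0 : 0 < t := lt_le_trans x0 t0.
      have d : is_derive t 1 (fun t => t `^ (1 - n%:R)) ((1 - n%:R) * t `^ (1 - n%:R - 1)).
        exact: is_derive1_powR.
      have := is_deriveN d.
      rewrite (_ : 1 - n%:R - 1 = - n%:R); last by ring.
      by rewrite -mulNr opprB.
    apply: continuous_in_subspaceT => t; rewrite inE/= in_itv/= => /andP[t0 t1].
    have {}t0 : 0 < t := lt_le_trans x0 t0.
    apply: cvgM; first exact: cvg_cst.
    apply: (@is_derive_continuous _ (fun t => t `^ (- n%:R))).
    exact: is_derive1_powR.
  by rewrite powR1 -EFinB -EFinD lee_fin; lra.
rewrite (@le_lt_trans _ _ (\int[leb n]_(x in [set x | enorm x <= 1]%R) (1 + h x))%E)//.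
  apply: ge0_le_integral => //.
  - by move=> x _; rewrite lee_fin powR_ge0.
  - exact: measurable_funTS.
  - by apply: measurable_funTS; apply: emeasurable_funD => //; exact: measurable_layer.
rewrite ge0_integralD//; last first.
  by apply: measurable_funTS; exact: measurable_layer.
rewrite integral_cst//= mul1e unit_ball_volumeE lte_add_pinfty ?ltry//.
rewrite (@le_lt_trans _ _ (\int[leb n]_x h x)%E)//.
  apply: ge0_subset_integral => //.
  exact: measurable_layer.
rewrite layer_cake//.
rewrite (@le_lt_trans _ _
  (\int[mu]_(t in `[0%R, 1%R]) ((n%:R - 1) * unit_ball_volume n)%:E)%E)//.
  apply: ge0_le_integral => //.
  - move=> t; rewrite /= in_itv/= => /andP[t0 _].
    by rewrite lee_fin mulr_ge0// mulr_ge0 ?exprn_ge0// ltW// unit_ball_volume_gt0.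
  - apply/measurable_EFinP; apply: measurable_funTS; apply: measurable_funM => //.
    by apply: measurable_funM.
  - move=> t; rewrite /= in_itv/= => /andP[t0 _]; rewrite lee_fin /w.
    rewrite -mulrA ler_wpM2l ?subr_ge0// mulrA ler_piMl ?(ltW (unit_ball_volume_gt0 _))//.
    move: t0; rewrite le_eqVlt => /orP[/eqP <-|t0].
      by rewrite powR0 ?mul0r// oppr_eq0; lra.
    have tn0 : t ^+ n != 0 by apply: expf_neq0; rewrite gt_eqF.
    by rewrite powR_invn ?(ltW t0)// mulVf.
rewrite (@integral_cst _ _ _ mu _ _ ((n%:R - 1) * unit_ball_volume n)%:E)//=.
by rewrite lebesgue_measure_itv/= lte_fin ltr01 -EFinB -EFinM ltry.
Qed.

End layer_cake.

(** * Continuity and differentiation under the integral sign *)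

Section under_integral.
Context {R : realType} (n : nat).
Local Notation E := 'rV[R]_n.
Local Notation e_ i := (delta_mx ord0 i : 'rV[R]_n).

Lemma derive_slice (f : E -> R) (x v : E) (h df : R) :
  is_derive h 1 (fun t => f (x + t *: v)) df <-> is_derive (x + h *: v) v f df.
Proof.
have key : (fun t : R => t^-1 *:
    (((fun t => f (x + t *: v)) \o shift h) (t *: (1 : R)) - f (x + h *: v))) =
    (fun t : R => t^-1 *: ((f \o shift (x + h *: v)) (t *: v) - f (x + h *: v))).
  apply/funext => t /=; congr (_ *: (f _ - _)).
  by rewrite scalerDl [t *: 1]mulr1 addrCA.
split=> -[d e].
  split; first by rewrite /derivable -key.
  by rewrite /derive -key.
split; first by rewrite /derivable key.
by rewrite /derive key.
Qed.

Lemma derive_slice0 (f : E -> R) (x v : E) (df : R) :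
  is_derive (0 : R) 1 (fun t => f (x + t *: v)) df <-> is_derive x v f df.
Proof. by rewrite derive_slice scale0r addr0. Qed.

Context d (T : measurableType d) (mu : {measure set T -> \bar R}).

(** Dominated convergence is about sequences, so a failure of continuity is first turned
    into a sequence converging to x0. *)
Lemma continuous_under_integral (f : E -> T -> R) (g : T -> R) (x0 : E) (e : R) :
  0 < e -> (forall x, mu.-integrable setT (EFin \o f x)) ->
  (forall y, {for x0, continuous (f ^~ y)}) ->
  mu.-integrable setT (EFin \o g) ->
  (forall x y, `|x - x0| < e -> `|f x y| <= g y) ->
  {for x0, continuous (fun x => \int[mu]_y f x y)}.
Proof.
move=> e0 intf cf intg fg.
have [h|/existsNP[eps /not_implyP[eps0 H]]] := pselect
  (forall eps, 0 < eps ->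
    \forall x \near x0, `|\int[mu]_y f x0 y - \int[mu]_y f x y| < eps).
  by apply/(@cvgrPdist_lt _ _ _ (nbhs x0) (nbhs_filter x0)) => eps eps0; exact: h.
exfalso.
have : forall k : nat, exists x, `|x - x0| < e / k.+1%:R /\
    eps <= `|\int[mu]_y f x0 y - \int[mu]_y f x y|.
  move=> k; apply: contrapT => /forallNP h; apply: H.
  apply/nbhs_ballP; exists (e / k.+1%:R); first by rewrite /= divr_gt0.
  move=> x; rewrite -ball_normE/= distrC => xk.
  by rewrite ltNge; apply/negP => h'; exact: (h x).
move=> /choice[u uP].
have ux0 : u k @[k --> \oo] --> x0.
  apply/cvgrPdist_lt => eta eta0.
  have [N _ hN] := near_infty_natSinv_lt (PosNum (divr_gt0 eta0 e0)).
  exists N => // k /= Nk; rewrite distrC (lt_trans (uP k).1)//.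
  by have := hN k Nk; rewrite /= ltr_pdivlMr// mulrC.
have ue k : `|u k - x0| < e.
  rewrite (lt_le_trans (uP k).1)// ler_pdivrMr// ler_peMr ?(ltW e0)//.
  by rewrite ler1n.
have mf x : measurable_fun setT (fun y => (f x y)%:E).
  exact: measurable_int (intf x).
have [] := @dominated_convergence _ T R mu setT measurableT (fun k y => (f (u k) y)%:E)
  (fun y => (f x0 y)%:E) (EFin \o g) (fun k => mf (u k)) (mf x0) _ intg _.
- apply: aeW => y _; apply: cvg_EFin; first exact: nearW.
  exact: (@cvg_comp _ _ _ u (f ^~ y) \oo (nbhs x0) (nbhs (f x0 y)) ux0 (cf y)).
- by apply: aeW => y k _; rewrite lee_fin; apply: fg; exact: ue.
move=> _ _ H1.
have {}H1 : \int[mu]_y f (u k) y @[k --> \oo] --> \int[mu]_y f x0 y.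
  rewrite /Rintegral; apply: fine_cvg.
  by rewrite fineK ?integrable_fin_num//; exact: intf.
move/cvgrPdist_lt : H1 => /(_ _ eps0)[N _ /(_ N (leqnn N))].
by rewrite /= ltNge (uP N).2.
Qed.

(** The one-variable theorem applied along the line through x0 with direction v. *)
Lemma derive_under_integral (f df : E -> T -> R) (v : E) (g : T -> R) (x0 : E) (e : R) :
  0 < e -> (forall x, mu.-integrable setT (EFin \o f x)) ->
  (forall x y, is_derive x v (f ^~ y) (df x y)) ->
  mu.-integrable setT (EFin \o g) ->
  (forall h y, `|h| < e -> `|df (x0 + h *: v) y| <= g y) ->
  is_derive x0 v (fun x => \int[mu]_y f x y) (\int[mu]_y df x0 y).
Proof.
move=> e0 intf cf intg fg; apply/derive_slice0.
have dd (h : R) y : is_derive h 1 (fun t => f (x0 + t *: v) y) (df (x0 + h *: v) y).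
  by apply/(derive_slice (f ^~ y)).
have dE (h : R) y :
    partial1of2 (fun (t : R) y => f (x0 + t *: v) y) h y = df (x0 + h *: v) y.
  by rewrite partial1of2E; have := dd h y => ?; rewrite derive_val.
have g0 y : 0 <= g y by rewrite (le_trans _ (fg 0 y _)) ?normr0.
have H := @cvg_differentiation_under_integral R d T mu
  (fun (t : R) y => f (x0 + t *: v) y) setT measurableT 0 (- e) e.
have {}H : h^-1 *: (\int[mu]_y f (x0 + (h + 0) *: v) y - \int[mu]_y f (x0 + 0 *: v) y)
    @[h --> 0^'] --> \int[mu]_y df x0 y.
  have -> : \int[mu]_y df x0 y =
      \int[mu]_y partial1of2 (fun (t : R) y => f (x0 + t *: v) y) 0 y.
    by apply: eq_Rintegral => y _; rewrite dE scale0r addr0.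
  apply: (H _ _ _ g) => //.
  - by rewrite /= in_itv/= oppr_lt0 e0.
  - by move=> x y; rewrite /= in_itv/= -ltr_norml dE => h _; exact: fg.
have {}H : h^-1 *: (((fun t => \int[mu]_y f (x0 + t *: v) y) \o shift 0) (h *: (1 : R)) -
    \int[mu]_y f (x0 + 0 *: v) y) @[h --> 0^'] --> \int[mu]_y df x0 y.
  apply: cvg_trans H; apply: near_eq_cvg; apply: nearW => h /=.
  by rewrite [h *: 1]mulr1.
split; first by apply/cvg_ex; eexists; exact: H.
by apply/cvg_lim => //; exact: H.
Qed.

Lemma continuous_bounded_ball (b : E -> R) (x : E) (r : R) : continuous b ->
  exists2 M, 0 <= M & forall z, `|z - x| <= r -> `|b z| <= M.
Proof.
move=> cb.
pose A := [set z : E | `|z - x| <= r].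
have cA : compact A.
  apply: bounded_closed_compact.
    exists (`|x| + r); split; first exact: num_real.
    move=> M M1 z /= zx; rewrite -(subrK x z) (le_trans (ler_normD _ _))//.
    by rewrite (le_trans _ (ltW M1))// addrC lerD2l.
  have -> : A = (fun z => `|z - x|) @^-1` [set t | t <= r] by [].
  apply: closed_comp; last exact: closed_le.
  move=> z _; apply: (@continuous_comp E E R (fun z => z - x) (fun z : E => `|z|)).
    by apply: (@continuousB _ _ _ (@id E) (cst x)) => //; exact: cst_continuous.
  exact: norm_continuous.
have [M [_ hM]] := compact_bounded (continuous_compact (continuous_subspaceT cb) cA).
exists (Num.max 0 (M + 1)); first by rewrite le_max lexx.
move=> z zr; rewrite le_max; apply/orP; right; apply: hM; first by rewrite ltrDl.
by exists z.
Qed.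

End under_integral.

(** * Convolution with a compactly supported kernel *)

Section convolution.
Context {R : realType} (n : nat).
Local Notation E := 'rV[R]_n.
Local Notation leb := (@lebesgue_rV R n).
Local Notation e_ i := (delta_mx ord0 i : 'rV[R]_n).

Definition conv (K a : E -> R) : E -> R := fun x => \int[leb]_y (K (x - y) * a y).

Lemma measurable_reflect (x : E) : measurable_fun setT (fun y : E => x - y).
Proof.
rewrite (_ : (fun y => _) = fun y => x + (-1) *: y); first exact: measurable_rV_affine.
by apply/funext => y; rewrite scaleN1r.
Qed.

Lemma lebesgue_rV_reflect (x : E) (A : set E) : measurable A ->
  leb ((fun y => x - y) @^-1` A) = leb A.
Proof.
move=> mA.
have mA' : measurable ((fun y => x - y) @^-1` A).
  by rewrite -[X in measurable X]setTI; exact: measurable_reflect.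
have m1 : measurable_fun setT (fun y : E => (\1_A y : R)%:E).
  by apply/measurable_EFinP; exact: measurable_indic.
rewrite -[X in leb X]setIT -integral_indic// -[X in _ = leb X]setIT -integral_indic//.
rewrite -(@ge0_integral_affine _ _ x (-1))//.
  rewrite normrN1 expr1n mul1e; apply: eq_integral => y _.
  rewrite !indicE; congr (nat_of_bool _)%:R%:E.
  by apply/idP/idP; rewrite !inE/= scaleN1r subKr.
by apply/measurable_EFinP; exact: measurable_indic.
Qed.

Lemma integrable_reflect (x : E) (f : E -> R) :
  leb.-integrable setT (EFin \o f) -> leb.-integrable setT (fun y => (f (x - y))%:E).
Proof.
move=> /integrableP[mf intf]; apply/integrableP; split.
  by apply: (measurableT_comp mf); exact: measurable_reflect.
apply: le_lt_trans intf.
have N1 : -1 != 0 :> R by rewrite oppr_eq0 oner_neq0.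
rewrite -(@ge0_integral_affine _ _ x (-1) (fun y => `|(EFin \o f) y|%E))//.
- rewrite normrN1 expr1n mul1e le_eqVlt; apply/orP; left; apply/eqP.
  by apply: eq_integral => y _; rewrite scaleN1r.
- exact: measurableT_comp.
Qed.

Lemma Rintegral_reflect (x : E) (f : E -> R) :
  leb.-integrable setT (EFin \o f) -> \int[leb]_y f (x - y) = \int[leb]_y f y.
Proof.
move=> intf; rewrite /Rintegral; congr fine.
have mr := measurable_reflect x.
transitivity (\int[pushforward leb (fun y => x - y)%R]_y (f y)%:E)%E; last first.
  by apply: eq_measure_integral => A mA _; exact: lebesgue_rV_reflect.
have mf := measurable_int _ intf; have i2 := integrable_reflect x intf.
by rewrite integral_pushforward.
Qed.

(** Derivatives may be put on either factor of a convolution; this form puts them on b. *)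
Lemma convC (K b : E -> R) (x : E) :
  leb.-integrable setT (fun y => (K y * b (x - y))%:E) ->
  conv K b x = \int[leb]_y (K y * b (x - y)).
Proof.
move=> h; rewrite -(Rintegral_reflect x h); apply: eq_Rintegral => y _.
by rewrite subKr.
Qed.

Section compact_kernel.
Variables (K : E -> R) (r : R).
Hypothesis intK : leb.-integrable setT (EFin \o K).
Hypothesis suppK : forall y, r < `|y| -> K y = 0.

Let mK : measurable_fun setT K.
Proof. by apply/measurable_EFinP; exact: measurable_int intK. Qed.

Lemma continuous_shift (b : E -> R) (x : E) : continuous b ->
  continuous (fun y : E => b (x - y)).
Proof.
move=> cb y; apply: (@continuous_comp E E R (fun y : E => x - y) b); last exact: cb.
by apply: (@continuousB _ _ _ (cst x) (@id E)) => //; exact: cst_continuous.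
Qed.

Lemma conv_cpt_bound (b : E -> R) (x0 : E) : continuous b ->
  exists2 M, 0 <= M & forall x y, `|x - x0| < 1 -> `|K y * b (x - y)| <= M * `|K y|.
Proof.
move=> cb; have [M M0 hM] := continuous_bounded_ball x0 (r + 1) cb.
exists M => // x y xx0; rewrite normrM mulrC.
have [ry|yr] := ltP r `|y|; first by rewrite suppK// normr0 !mulr0.
apply: ler_wpM2r => //; apply: hM.
by rewrite addrAC (le_trans (ler_normB _ _))// (addrC r) lerD// ltW.
Qed.

Lemma integrable_conv_cpt (b : E -> R) (x : E) : continuous b ->
  leb.-integrable setT (fun y => (K y * b (x - y))%:E).
Proof.
move=> cb; have [M M0 hM] := conv_cpt_bound x cb.
apply: (@le_integrable _ _ _ leb setT measurableT _ (fun y => (M * `|K y|)%:E)).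
- apply/measurable_EFinP; apply: measurable_funM => //.
  exact: (continuous_measurable_rV (@continuous_shift b x cb)).
- move=> y _; rewrite !abse_EFin lee_fin [leRHS]ger0_norm ?mulr_ge0//.
  by apply: hM; rewrite subrr normr0.
- under eq_fun do rewrite EFinM; apply: integrableZl => //.
  by apply: (@integrable_norm _ _ _ _ _ K).
Qed.

Lemma integrable_conv_cpt' (b : E -> R) (x : E) : continuous b ->
  leb.-integrable setT (fun y => (K (x - y) * b y)%:E).
Proof.
move=> cb; have := integrable_reflect x (@integrable_conv_cpt b x cb).
by under eq_fun do rewrite subKr.
Qed.

Lemma conv_cptE (b : E -> R) : continuous b ->
  conv K b = fun x => \int[leb]_y (K y * b (x - y)).
Proof. by move=> cb; apply/funext => x; apply: convC; exact: integrable_conv_cpt. Qed.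

Lemma continuous_conv_cpt (b : E -> R) : continuous b -> continuous (conv K b).
Proof.
move=> cb x0; rewrite conv_cptE//.
have [M M0 hM] := conv_cpt_bound x0 cb.
apply: (@continuous_under_integral R n _ _ leb (fun x y => K y * b (x - y))
  (fun y => M * `|K y|) x0 1) => //.
- by move=> x; exact: integrable_conv_cpt.
- move=> y; apply: continuousM; first exact: cst_continuous.
  apply: (@continuous_comp E E R (fun x : E => x - y) b); last exact: cb.
  by apply: (@continuousB _ _ _ (@id E) (cst y)) => //; exact: cst_continuous.
- rewrite /comp; under eq_fun do rewrite EFinM; apply: integrableZl => //.
  by apply: (@integrable_norm _ _ _ _ _ K).
Qed.

(** All derivatives fall on b, and only a neighbourhood of x matters for K * b, so that
    nothing has to be known about b at infinity. This is what allows a kernel that is merely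
    integrable. *)
Lemma derive_conv_cpt (b : E -> R) (v x : E) : continuous b ->
  (forall x, derivable b x v) -> continuous ('D_v b) ->
  is_derive x v (conv K b) (conv K ('D_v b) x).
Proof.
move=> cb db cdb; rewrite !conv_cptE//.
have [M M0 hM] := conv_cpt_bound x cdb.
pose e := (1 + `|v|)^-1.
have e0 : 0 < e by rewrite invr_gt0 ltr_pwDl.
apply: (@derive_under_integral R n _ _ leb (fun x y => K y * b (x - y))
  (fun x y => K y * 'D_v b (x - y)) v (fun y => M * `|K y|) x e) => //.
- by move=> x'; exact: integrable_conv_cpt.
- move=> x' y.
  have d : is_derive x' v (fun x : E => b (x - y)) ('D_v b (x' - y)).
    apply/derive_slice0.
    have : is_derive (x' - y) v b ('D_v b (x' - y)) by split.
    move/derive_slice0; congr (is_derive _ _ _ _).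
    by apply/funext => t; rewrite addrAC.
  exact: (@is_deriveZ _ _ _ (fun x => b (x - y)) (K y) x' v _ d).
- rewrite /comp; under eq_fun do rewrite EFinM; apply: integrableZl => //.
  by apply: (@integrable_norm _ _ _ _ _ K).
- move=> h y he; apply: hM; rewrite addrAC subrr add0r normrZ.
  rewrite (@le_lt_trans _ _ (`|h| * (1 + `|v|)))//.
    by rewrite ler_wpM2l// lerDr.
  by rewrite -ltr_pdivlMr ?mul1r// ltr_pwDl.
Qed.

Lemma Ck_conv_cpt (k : nat) (b : E -> R) : Ck k b -> Ck k (conv K b).
Proof.
elim: k b => [|k IH] b /= [cb].
  by move=> _; split => //; exact: continuous_conv_cpt.
move=> h; split; first exact: continuous_conv_cpt.
move=> i; have [db Cb] := h i.
have cdb : continuous (partial i b) by case: k Cb {IH h} => [|k] [].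
have d x := @derive_conv_cpt b (e_ i) x cb db cdb.
split; first by move=> x; case: (d x).
rewrite (_ : partial i _ = conv K (partial i b)); first exact: IH.
by apply/funext => x; rewrite /partial; have := d x => ?; rewrite derive_val.
Qed.

Lemma partial_conv_cpt (i : 'I_n) (b : E -> R) : Ck 1 b ->
  partial i (conv K b) = conv K (partial i b).
Proof.
move=> [cb /(_ i)[db [cdb _]]].
have d x := @derive_conv_cpt b (e_ i) x cb db cdb.
by apply/funext => x; rewrite /partial; have := d x => ?; rewrite derive_val.
Qed.

Lemma laplacian_conv_cpt (b : E -> R) : Ck 2 b ->
  laplacian (conv K b) = conv K (laplacian b).
Proof.
move=> Cb.
have C1 i : Ck 1 (partial i b) by case: Cb => _ /(_ i)[].
have C1b : Ck 1 b.
  case: Cb => cb h; split => // i; have [h1 [h2 _]] := h i; by split.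
have c2 i : continuous (partial i (partial i b)) by case: (C1 i) => _ /(_ i)[_ []].
apply/funext => x; rewrite /laplacian /conv.
rewrite (_ : \int[leb]_y _ =
    \int[leb]_y \sum_i (K (x - y) * partial i (partial i b) y)); last first.
  by apply: eq_Rintegral => y _; rewrite mulr_sumr.
rewrite /Rintegral.
rewrite (_ : (\int[leb]_y _ =
    \sum_i \int[leb]_y (K (x - y) * partial i (partial i b) y)%:E)%E); last first.
  rewrite -integral_sum//; last by move=> i; exact: integrable_conv_cpt'.
  by apply: eq_integral => y _; rewrite sumEFin.
rewrite -sum_fine; last first.
  by move=> i _; apply: integrable_fin_num => //; exact: integrable_conv_cpt'.
by apply: eq_bigr => i _; rewrite partial_conv_cpt// partial_conv_cpt.
Qed.

End compact_kernel.

End convolution.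

(** * Convolution with a smooth kernel *)

Section smooth_kernel.
Context {R : realType} (n : nat).
Local Notation E := 'rV[R]_n.
Local Notation leb := (@lebesgue_rV R n).
Local Notation e_ i := (delta_mx ord0 i : 'rV[R]_n).
Variable a : E -> R.
Hypothesis inta : leb.-integrable setT (EFin \o a).

Let ma : measurable_fun setT a.
Proof. by apply/measurable_EFinP; exact: measurable_int inta. Qed.

Let inta' (M : R) : leb.-integrable setT (fun y => (M * `|a y|)%:E).
Proof.
under eq_fun do rewrite EFinM; apply: integrableZl => //.
by apply: (@integrable_norm _ _ _ _ _ a).
Qed.

Lemma integrable_conv_bounded (H : E -> R) (M : R) (x : E) :
  continuous H -> (forall y, `|H y| <= M) ->
  leb.-integrable setT (fun y => (H (x - y) * a y)%:E).
Proof.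
move=> cH HM.
apply: (@le_integrable _ _ _ leb setT measurableT _ (fun y => (M * `|a y|)%:E)) => //.
- apply/measurable_EFinP; apply: measurable_funM => //.
  exact: (continuous_measurable_rV (@continuous_shift R n H x cH)).
- move=> y _; rewrite !abse_EFin lee_fin normrM (le_trans _ (ler_norm _))//.
  by rewrite ler_wpM2r.
Qed.

(** G need not be bounded (the logarithmic and the one-dimensional kernels are not): if
    its oscillation on unit cubes is bounded, the integrands near x0 are dominated by the one
    at x0 plus a multiple of |a|. *)
Lemma continuous_conv (G : E -> R) (M : R) : continuous G ->
  (forall x z, `|z| <= 1 -> `|G (x + z) - G x| <= M) ->
  (forall x, leb.-integrable setT (fun y => (G (x - y) * a y)%:E)) ->
  continuous (conv G a).
Proof.
move=> cG oscG intG x0; rewrite /conv.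
apply: (@continuous_under_integral R n _ _ leb (fun x y => G (x - y) * a y)
  (fun y => `|G (x0 - y) * a y| + M * `|a y|) x0 1) => //.
- move=> y; apply: continuousM; last exact: cst_continuous.
  apply: (@continuous_comp E E R (fun x : E => x - y) G); last exact: cG.
  by apply: (@continuousB _ _ _ (@id E) (cst y)) => //; exact: cst_continuous.
- rewrite /comp; under eq_fun do rewrite EFinD; apply: integrableD => //.
  have := integrable_norm (intG x0); exact.
- move=> x y xx0; rewrite -(subrK (G (x0 - y)) (G (x - y))) mulrDl addrC.
  rewrite (le_trans (ler_normD _ _))// lerD// normrM ler_wpM2r//.
  have -> : x - y = (x0 - y) + (x - x0) by rewrite [RHS]addrC addrA subrK.
  exact: oscG (ltW xx0).
Qed.

(** Here all derivatives fall on the kernel, so that only the integrability of a is used. *)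
Lemma is_derive_conv (G H : E -> R) (M : R) (v x : E) :
  (forall x, is_derive x v G (H x)) -> (forall x, `|H x| <= M) ->
  (forall x, leb.-integrable setT (fun y => (G (x - y) * a y)%:E)) ->
  is_derive x v (conv G a) (conv H a x).
Proof.
move=> dG HM intG.
apply: (@derive_under_integral R n _ _ leb (fun x y => G (x - y) * a y)
  (fun x y => H (x - y) * a y) v (fun y => M * `|a y|) x 1) => //; last first.
- by move=> h y _; rewrite normrM ler_wpM2r.
- exact: inta'.
move=> x' y.
have d : is_derive x' v (fun x : E => G (x - y)) (H (x' - y)).
  apply/derive_slice0; have /derive_slice0 := dG (x' - y).
  by congr (is_derive _ _ _ _); apply/funext => t; rewrite addrAC.
have := @is_deriveZ _ _ _ (fun x : E => G (x - y)) (a y) x' v _ d.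
by congr (is_derive _ _ _ _); [apply/funext => t|]; rewrite mulrC.
Qed.

Variables (G : E -> R) (G1 : 'I_n -> E -> R) (G2 : 'I_n -> 'I_n -> E -> R) (M : R).
Hypothesis cG : continuous G.
Hypothesis oscG : forall x z, `|z| <= 1 -> `|G (x + z) - G x| <= M.
Hypothesis dG : forall i x, is_derive x (e_ i) G (G1 i x).
Hypothesis dG1 : forall i j x, is_derive x (e_ j) (G1 i) (G2 i j x).
Hypothesis cG1 : forall i, continuous (G1 i).
Hypothesis cG2 : forall i j, continuous (G2 i j).
Hypothesis bG1 : forall i x, `|G1 i x| <= M.
Hypothesis bG2 : forall i j x, `|G2 i j x| <= M.
Hypothesis intG : forall x, leb.-integrable setT (fun y => (G (x - y) * a y)%:E).

Let continuous_conv_bounded (H : E -> R) : continuous H -> (forall x, `|H x| <= M) ->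
  continuous (conv H a).
Proof.
move=> cH HM; apply: (@continuous_conv H (M + M)) => //.
  by move=> x z _; rewrite (le_trans (ler_normB _ _))// lerD.
by move=> x; exact: integrable_conv_bounded cH HM.
Qed.

Let d1 i x : is_derive x (e_ i) (conv G a) (conv (G1 i) a x).
Proof. exact: (@is_derive_conv G (G1 i) M). Qed.

Let p1 i : partial i (conv G a) = conv (G1 i) a.
Proof. by apply/funext => x; rewrite /partial; have := d1 i x => ?; rewrite derive_val. Qed.

Let d2 i j x : is_derive x (e_ j) (conv (G1 i) a) (conv (G2 i j) a x).
Proof.
apply: (@is_derive_conv (G1 i) (G2 i j) M) => // y.
by apply: (@integrable_conv_bounded _ M).
Qed.

Let p2 i j : partial j (conv (G1 i) a) = conv (G2 i j) a.
Proof. by apply/funext => x; rewrite /partial; have := d2 i j x => ?; rewrite derive_val. Qed.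

Lemma Ck2_conv : Ck 2 (conv G a).
Proof.
split; first exact: continuous_conv cG oscG intG.
move=> i; split; first by move=> x; case: (d1 i x).
rewrite p1; split; first exact: continuous_conv_bounded.
move=> j; split; first by move=> x; case: (d2 i j x).
by rewrite p2; split => //; exact: continuous_conv_bounded.
Qed.

Lemma laplacian_conv : laplacian (conv G a) = conv (fun x => \sum_i G2 i i x) a.
Proof.
apply/funext => x; rewrite /laplacian.
under eq_bigr do rewrite p1 p2.
rewrite /conv [in RHS]/Rintegral.
rewrite (_ : (\int[leb]_y _ = \sum_i \int[leb]_y (G2 i i (x - y) * a y)%:E)%E); last first.
  rewrite -integral_sum//; last first.
    by move=> i; exact: (@integrable_conv_bounded _ M).
  by apply: eq_integral => y _; rewrite mulr_suml sumEFin.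
rewrite -sum_fine// => i _; apply: integrable_fin_num => //.
exact: (@integrable_conv_bounded _ M).
Qed.

End smooth_kernel.

(** * Calculus of radial functions *)

Section radial_calculus.
Context {R : realType} (n : nat).
Local Notation E := 'rV[R]_n.
Local Notation e_ i := (delta_mx ord0 i : 'rV[R]_n).

Lemma is_derive_coord (x v : E) (i : 'I_n) :
  is_derive x v (fun y : E => y ord0 i) (v ord0 i).
Proof.
have H : h^-1 *: (((fun y : E => y ord0 i) \o shift x) (h *: v) - x ord0 i)
    @[h --> (0 : R)^'] --> v ord0 i.
  apply: (@cvg_trans _ (cst (v ord0 i) h @[h --> (0 : R)^'])); last exact: cvg_cst.
  apply: near_eq_cvg; near=> h.
  rewrite /= !mxE addrK /GRing.scale/= mulKf//.
  by near: h; exact: nbhs_dnbhs_neq.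
by split; [apply/cvg_ex; eexists; exact: H|apply/cvg_lim => //; exact: H].
Unshelve. all: by end_near. Qed.

Lemma is_derive_sqn (x v : E) :
  is_derive x v (@sqn R n) (2 * \sum_i x ord0 i * v ord0 i).
Proof.
rewrite (_ : @sqn R n = \sum_(i < n) (fun y : E => y ord0 i) ^+ 2); last first.
  by apply/funext => y; rewrite /sqn fct_sumE.
rewrite mulr_sumr.
rewrite (_ : \sum_(i < n) _ =
    \sum_(i < n) ((2%:R * x ord0 i ^+ 1) *: v ord0 i)); last first.
  by apply: eq_bigr => i _; rewrite expr1 mulrA.
exact: (@is_derive_sum R E R n (fun i => (fun y : E => y ord0 i) ^+ 2) x v _
  (fun i => @is_deriveX R E (fun y : E => y ord0 i) 2 x v _ (is_derive_coord x v i))).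
Qed.

(** The chain rule along the line x + t v, on which |.|^2 is a polynomial in t. *)
Lemma is_derive_radial (g : R -> R) (dg : R) (x v : E) :
  is_derive (sqn x) 1 g dg ->
  is_derive x v (fun y : E => g (sqn y)) (dg * (2 * \sum_i x ord0 i * v ord0 i)).
Proof.
move=> d; apply/derive_slice0.
have d' : is_derive (0 : R) 1 (fun t => sqn (x + t *: v)) (2 * \sum_i x ord0 i * v ord0 i).
  by apply/derive_slice0; exact: is_derive_sqn.
have d0 : is_derive (sqn (x + 0 *: v)) 1 g dg by rewrite scale0r addr0.
exact: (@is_derive1_comp _ g (fun t => sqn (x + t *: v)) 0 _ _ d0 d').
Qed.

Lemma sum_delta (x : E) (i : 'I_n) : \sum_j x ord0 j * (e_ i) ord0 j = x ord0 i.
Proof.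
rewrite (bigD1 i)//= big1 ?addr0 ?mxE ?eqxx ?mulr1// => j ji.
by rewrite mxE eqxx/= (negbTE ji) mulr0.
Qed.

Variables (g g1 g2 : R -> R).
Hypothesis dg : forall s : R, is_derive s 1 g (g1 s).
Hypothesis dg1 : forall s : R, is_derive s 1 g1 (g2 s).
Hypothesis cg2 : continuous g2.

Definition radial1 (i : 'I_n) (x : E) : R := 2 * x ord0 i * g1 (sqn x).
Definition radial2 (i j : 'I_n) (x : E) : R :=
  2 * (i == j)%:R * g1 (sqn x) + 4 * x ord0 i * x ord0 j * g2 (sqn x).

Lemma is_derive_radial1 i x : is_derive x (e_ i) (fun y : E => g (sqn y)) (radial1 i x).
Proof.
have := @is_derive_radial g _ x (e_ i) (dg (sqn x)).
by rewrite sum_delta /radial1; congr (is_derive _ _ _ _); ring.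
Qed.

Lemma is_derive_radial2 i j x : is_derive x (e_ j) (radial1 i) (radial2 i j x).
Proof.
have d := @is_derive_radial g1 _ x (e_ j) (dg1 (sqn x)).
have c := @is_derive_coord x (e_ j) i.
have := @is_deriveZ _ _ _ _ 2 x (e_ j) _ (@is_deriveM _ _ _ _ x (e_ j) _ _ c d).
rewrite sum_delta; congr (is_derive _ _ _ _).
  by apply/funext => y; rewrite /radial1 -mulrA.
rewrite /radial2 /GRing.scale/= mxE eqxx/=; ring.
Qed.

Lemma continuous_radial (h : R -> R) : continuous h -> continuous (fun y : E => h (sqn y)).
Proof.
move=> ch x; apply: (@continuous_comp E R R (@sqn R n) h); last exact: ch.
exact: sqn_continuous.
Qed.

Lemma continuous_radial1 i : continuous (radial1 i).
Proof.
have c1 : continuous g1 by move=> s; exact: is_derive_continuous (dg1 s).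
move=> x; apply: (@continuousM _ _ (fun x : E => 2 * x ord0 i) (fun x : E => g1 (sqn x)));
  last exact: (continuous_radial c1).
by apply: continuousM; [exact: cst_continuous|exact: coord_continuous].
Qed.

Lemma continuous_radial2 i j : continuous (radial2 i j).
Proof.
have c1 : continuous g1 by move=> s; exact: is_derive_continuous (dg1 s).
move=> x; apply: (@continuousD _ _ _ (fun x : E => 2 * (i == j)%:R * g1 (sqn x))
  (fun x : E => 4 * x ord0 i * x ord0 j * g2 (sqn x))).
  by apply: continuousM; [exact: cst_continuous|exact: (continuous_radial c1)].
apply: continuousM; last exact: (continuous_radial cg2).
apply: continuousM; last exact: coord_continuous.
by apply: continuousM; [exact: cst_continuous|exact: coord_continuous].
Qed.

Variable M : R.
Hypothesis bg1 : forall s, 0 <= s -> `|g1 s| <= M.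
Hypothesis bsg1 : forall s, 0 <= s -> Num.sqrt s * `|g1 s| <= M.
Hypothesis bsg2 : forall s, 0 <= s -> s * `|g2 s| <= M.

Lemma radial1_bound i x : `|radial1 i x| <= 2 * M.
Proof.
rewrite /radial1 !normrM ger0_norm// -mulrA ler_wpM2l//.
rewrite (le_trans _ (bsg1 (sqn_ge0 x)))// ler_wpM2r//; exact: coord_le_enorm.
Qed.

Lemma radial2_bound i j x : `|radial2 i j x| <= 6 * M.
Proof.
have M0 : 0 <= M by rewrite (le_trans _ (bg1 (lexx 0))).
rewrite /radial2 (le_trans (ler_normD _ _))//.
rewrite (_ : 6 * M = 2 * M + 4 * M); last by ring.
apply: lerD; rewrite !normrM.
  rewrite ger0_norm//; case: (i == j); rewrite ?normr0 ?normr1 ?mulr1 ?mulr0 ?mul0r.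
    by rewrite ler_wpM2l// bg1// sqn_ge0.
  by rewrite mulr_ge0.
rewrite ger0_norm// -!mulrA ler_wpM2l//.
rewrite (le_trans _ (bsg2 (sqn_ge0 x)))// mulrA ler_wpM2r// -sqr_enorm expr2.
by rewrite ler_pM//; exact: coord_le_enorm.
Qed.

(** Mean value theorem on the segment from x to x + z. *)
Lemma radial_osc (x z : E) :
  `|g (sqn (x + z)) - g (sqn x)| <= 2 * n%:R * M * `|z|.
Proof.
pose phi (t : R) := g (sqn (x + t *: z)).
pose dphi (t : R) := g1 (sqn (x + t *: z)) * (2 * \sum_i (x + t *: z) ord0 i * z ord0 i).
have d (t : R) : is_derive t 1 phi (dphi t).
  by apply/(derive_slice (fun y => g (sqn y))); exact: is_derive_radial.
have [c _ e] : exists2 c, c \in `]0, 1[%R & phi 1 - phi 0 = dphi c * (1 - 0).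
  apply: MVT => //.
  by apply: continuous_subspaceT => t; exact: is_derive_continuous (d t).
have -> : g (sqn (x + z)) - g (sqn x) = dphi c.
  by move: e; rewrite /phi scale1r scale0r addr0 subr0 mulr1.
rewrite /dphi normrM mulrC normrM ger0_norm// -!mulrA ler_wpM2l//.
set y := x + c *: z.
rewrite (@le_trans _ _ ((n%:R * (enorm y * `|z|)) * `|g1 (sqn y)|))//; last first.
  rewrite -!mulrA ler_wpM2l// mulrCA [leRHS]mulrC ler_wpM2l//.
  exact: bsg1 (sqn_ge0 y).
rewrite ler_wpM2r// (le_trans (ler_norm_sum _ _ _))//.
apply: (@le_trans _ _ (\sum_(i < n) (enorm y * `|z|))).
  apply: ler_sum => i _; rewrite normrM ler_pM ?coord_le_enorm//.
  exact: coord_le_norm.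
by rewrite sumr_const card_ord mulr_natl.
Qed.

End radial_calculus.

(** * The profile of the fundamental solution *)

Section glue.
Context {R : realType}.

(** Difference quotients of the glued function at s0 are difference quotients of one of
    the two pieces, and both converge to the same limit. *)
Lemma is_derive_glue (f h df dh : R -> R) (s0 s : R) :
  (forall t, t <= s0 -> is_derive t 1 f (df t)) ->
  (forall t, s0 <= t -> is_derive t 1 h (dh t)) ->
  f s0 = h s0 -> df s0 = dh s0 ->
  is_derive s 1 (fun t => if t <= s0 then f t else h t)
    (if s <= s0 then df s else dh s).
Proof.
move=> Df Dh fh dfh.
have [s0s|ss0|s0E] := ltgtP s0 s.
- apply: (near_eq_is_derive _ (Dh s (ltW s0s))) => //.
  near=> t; rewrite ifF//; apply/negbTE; rewrite -ltNge.
  by near: t; exact: lt_nbhsr.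
- apply: (near_eq_is_derive _ (Df s (ltW ss0))) => //.
  near=> t; rewrite ifT//; apply: ltW.
  by near: t; exact: lt_nbhsl.
rewrite -s0E /=.
have quot (u : R -> R) (du : R) : is_derive s0 1 u du ->
    t^-1 *: (u (t + s0) - u s0) @[t --> (0 : R)^'] --> du.
  move=> [d e]; move/cvg_ex : d => [l hl].
  have : t^-1 *: ((u \o shift s0) (t *: (1 : R)) - u s0) @[t --> (0 : R)^'] --> du.
    by rewrite -e /derive (cvg_lim _ hl).
  apply: cvg_trans; apply: near_eq_cvg; apply: nearW => t /=.
  by rewrite [t *: 1]mulr1.
set k := fun t => if t <= s0 then f t else h t.
have H : t^-1 *: ((k \o shift s0) (t *: (1 : R)) - k s0) @[t --> (0 : R)^'] --> df s0.
  apply/cvgrPdist_lt => eps eps0.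
  have /cvgrPdist_lt/(_ _ eps0) Hf := quot _ _ (Df s0 (lexx _)).
  have /cvgrPdist_lt/(_ _ eps0) Hh := quot _ _ (Dh s0 (lexx _)).
  near=> t.
  rewrite /= /k lexx [t *: 1]mulr1.
  case: ifPn => _; first by near: t.
  by rewrite dfh fh; near: t.
by split; [apply/cvg_ex; eexists; exact: H|apply/cvg_lim => //; exact: H].
Unshelve. all: by end_near. Qed.

Lemma is_derive_quadratic (A B C s0 t : R) :
  is_derive t 1 (fun s => A + B * (s - s0) + C * (s - s0) ^+ 2)
    (B + 2 * C * (t - s0)).
Proof.
have dl : is_derive t 1 ((@idfun R) - cst s0) (1 - 0).
  exact: (is_deriveB (is_derive_id t 1) (is_derive_cst s0 t 1)).
have dq := @is_deriveX R R _ 2 t 1 _ dl.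
have := is_deriveD (is_deriveD (is_derive_cst A t (1 : R)) (is_deriveZ B dl))
  (is_deriveZ C dq).
congr (is_derive _ _ _ _).
by rewrite /GRing.scale/= -[((@idfun R) - cst s0) t]/(t - s0); ring.
Qed.

End glue.

Section profile.
Context {R : realType} (m : nat).
Let n := m.+1.
Let w : R := @unit_ball_volume R n.
Let w0 : 0 < w. Proof. exact: unit_ball_volume_gt0. Qed.

(** The profile of the fundamental solution as a function of |x|^2: in this variable the
    Taylor polynomials used below are polynomials in x. *)
Definition fund (s : R) : R :=
  match n with
  | 1 => - (Num.sqrt s / 2)
  | 2 => - ((2 * pi)^-1 * ln (Num.sqrt s))
  | _ => (n%:R * (n - 2)%:R * w)^-1 * Num.sqrt s ^- (n - 2)
  end.

Lemma PhiE (x : 'rV[R]_n) : Phi x = fund (sqn x).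
Proof. by move: x; rewrite /Phi /fund /w /n; case: m => [|[|k]] x. Qed.

(** The constant making the derivative of the profile equal to - kappa s^(-n/2) in every
    dimension. *)
Definition fund_const : R := (2 * n%:R * w)^-1.
Local Notation kappa := fund_const.

Lemma fund_const_gt0 : 0 < kappa.
Proof. by rewrite invr_gt0 !mulr_gt0. Qed.

Let p : R := n%:R / 2.

Definition dfund (s : R) : R := - kappa * s `^ (- p).
Definition ddfund (s : R) : R := kappa * p * s `^ (- p - 1).

Lemma powR_half (s : R) : 0 < s -> s `^ (- p) = Num.sqrt s ^- n.
Proof.
move=> s0; rewrite powRN /p mulrC powRrM powR12_sqrt ?ltW//.
by rewrite powR_mulrn// sqrtr_ge0.
Qed.

(** This is where the three normalizations of the fundamental solution meet: the volumes
    2 and pi of the unit ball in dimensions one and two turn the formulas for those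
    dimensions into the general one. *)
Lemma is_derive_fund (s : R) : 0 < s -> is_derive s 1 fund (dfund s).
Proof.
move=> s0; rewrite /dfund powR_half// /fund_const.
have t0 : 0 < Num.sqrt s by rewrite sqrtr_gt0.
have tn : Num.sqrt s != 0 by rewrite gt_eqF.
have dt : is_derive s 1 Num.sqrt (2 * Num.sqrt s)^-1 by exact: is_derive1_sqrt.
move: w0; rewrite /fund /w /n; case: m => [|[|k]] w1.
- rewrite unit_ball_volume1.
  have -> : (fun s : R => - (Num.sqrt s / 2)) = (- 2^-1) *: Num.sqrt.
    by apply/funext => u; rewrite -[RHS]/(- 2^-1 * Num.sqrt u) mulNr mulrC.
  have -> : - (2 * 1 * 2)^-1 * Num.sqrt s ^- 1 = (- 2^-1) * (2 * Num.sqrt s)^-1 :> R.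
    by rewrite expr1; field.
  exact: is_deriveZ.
- rewrite unit_ball_volume2.
  have pi0 : (pi : R) != 0 by rewrite gt_eqF ?pi_gt0.
  have -> : (fun s : R => - ((2 * pi)^-1 * ln (Num.sqrt s))) =
      (- (2 * pi)^-1) *: (@ln R \o Num.sqrt).
    by apply/funext => u; rewrite -[RHS]/(- (2 * pi)^-1 * ln (Num.sqrt u)) mulNr.
  have -> : - (2 * 2 * pi)^-1 * Num.sqrt s ^- 2 =
      (- (2 * pi)^-1) * ((Num.sqrt s)^-1 * (2 * Num.sqrt s)^-1) :> R.
    by rewrite expr2 !mulNr -!invfM; congr (- _^-1); ring.
  have dl : is_derive (Num.sqrt s) 1 (@ln R) (Num.sqrt s)^-1 by exact: is_derive1_ln.
  exact: (is_deriveZ _ (is_derive1_comp dl dt)).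
- set c := (k.+3%:R * _ * _)^-1.
  have -> : (fun s : R => c * Num.sqrt s ^- (k.+3 - 2)) =
      c *: ((fun t => t `^ (- k.+1%:R)) \o Num.sqrt).
    apply/funext => u; rewrite -[RHS]/(c * Num.sqrt u `^ (- k.+1%:R)).
    by rewrite powR_invn ?sqrtr_ge0.
  have dp : is_derive (Num.sqrt s) 1 (fun t => t `^ (- k.+1%:R))
      (- k.+1%:R * Num.sqrt s `^ (- k.+1%:R - 1)) by exact: is_derive1_powR.
  have := is_deriveZ c (is_derive1_comp dp dt).
  congr (is_derive _ _ _ _).
  have -> : - k.+1%:R - 1 = - k.+2%:R :> R by rewrite -[k.+2%:R]natr1; ring.
  rewrite powR_invn ?ltW// /c /GRing.scale/= subn2/= (exprS _ k.+2).
  have k1 : k.+1%:R != 0 :> R by rewrite pnatr_eq0.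
  have k3 : k.+3%:R != 0 :> R by rewrite pnatr_eq0.
  have tk : Num.sqrt s ^+ k.+2 != 0 by rewrite expf_neq0.
  have wn : unit_ball_volume k.+3 != 0 :> R by rewrite gt_eqF.
  by field; rewrite tk tn wn /= -natrD nat1r !pnatr_eq0.
Qed.

Lemma is_derive_dfund (s : R) : 0 < s -> is_derive s 1 dfund (ddfund s).
Proof.
move=> s0.
have d : is_derive s 1 (fun s => s `^ (- p)) (- p * s `^ (- p - 1)) by exact: is_derive1_powR.
have := is_deriveZ (- kappa) d; congr (is_derive _ _ _ _).
by rewrite /ddfund /GRing.scale/= mulrA mulrNN.
Qed.

Variable r : R.
Hypothesis r0 : 0 < r.
Let s0 := r ^+ 2.
Let s00 : 0 < s0. Proof. exact: exprn_gt0. Qed.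

(** The singularity of the profile on [0, r^2] is replaced by the second-order Taylor
    polynomial at r^2. Two orders are exactly what makes cap twice continuously
    differentiable. *)
Definition cap (s : R) : R :=
  if s <= s0 then fund s0 + dfund s0 * (s - s0) + ddfund s0 / 2 * (s - s0) ^+ 2
  else fund s.
Definition dcap (s : R) : R :=
  if s <= s0 then dfund s0 + ddfund s0 * (s - s0) else dfund s.
Definition ddcap (s : R) : R := ddfund (Num.max s s0).

Lemma is_derive_cap (s : R) : is_derive s 1 cap (dcap s).
Proof.
apply: (@is_derive_glue R
  (fun s => fund s0 + dfund s0 * (s - s0) + ddfund s0 / 2 * (s - s0) ^+ 2) fund
  (fun s => dfund s0 + ddfund s0 * (s - s0)) dfund).
- move=> t _; have := is_derive_quadratic (fund s0) (dfund s0) (ddfund s0 / 2) s0 t.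
  by congr (is_derive _ _ _ _); field.
- by move=> t st; apply: is_derive_fund; exact: lt_le_trans st.
- by rewrite subrr expr0n !mulr0 !addr0.
- by rewrite subrr !mulr0 !addr0.
Qed.

Lemma is_derive_dcap (s : R) : is_derive s 1 dcap (ddcap s).
Proof.
have -> : ddcap s = if s <= s0 then ddfund s0 else ddfund s.
  rewrite /ddcap; case: ifPn => h; first by rewrite (max_idPr h).
  by rewrite (max_idPl _)// ltW// ltNge.
apply: (@is_derive_glue R (fun s => dfund s0 + ddfund s0 * (s - s0)) dfund
  (fun s => ddfund s0) ddfund) => //.
- move=> t _; have := is_derive_quadratic (dfund s0) (ddfund s0) 0 s0 t.
  congr (is_derive _ _ _ _); first by apply/funext => u; rewrite mul0r addr0.
  by rewrite mulr0 mul0r addr0.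
- by move=> t st; apply: is_derive_dfund; exact: lt_le_trans st.
- by rewrite subrr !mulr0 !addr0.
Qed.

Lemma continuous_ddcap : continuous ddcap.
Proof.
move=> s; rewrite /ddcap.
apply: (@continuous_comp _ _ _ (fun s => Num.max s s0) ddfund).
  by apply: continuous_max; [exact: cvg_id|exact: cst_continuous].
apply: (@continuousM _ _ (cst (kappa * p)) (fun t => t `^ (- p - 1))).
  exact: cst_continuous.
apply: (@is_derive_continuous _ (fun t => t `^ (- p - 1))).
by apply: is_derive1_powR; rewrite lt_max s00 orbT.
Qed.

Let sqrts0 : Num.sqrt s0 = r.
Proof. by rewrite sqrtr_sqr gtr0_norm. Qed.

(** Minus the derivative of the profile at r^2. *)
Definition slope : R := kappa * r ^- n.
Local Notation A := slope.

Lemma slope_gt0 : 0 < A.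
Proof. by rewrite mulr_gt0 ?fund_const_gt0// invr_gt0 exprn_gt0. Qed.

Let p0 : 0 < p.
Proof. by rewrite /p divr_gt0. Qed.

Lemma dfund_s0 : dfund s0 = - A.
Proof. by rewrite /dfund powR_half// sqrts0 mulNr. Qed.

Lemma ddfundE s : 0 < s -> ddfund s = - p * dfund s / s.
Proof.
move=> sp; rewrite /ddfund /dfund powRB; last by rewrite (gt_eqF sp) implybT.
by rewrite powRr1 ?ltW//; field; rewrite gt_eqF.
Qed.

Lemma ddfund_s0 : ddfund s0 = A * p / s0.
Proof. by rewrite ddfundE// dfund_s0 mulrNN [p * _]mulrC. Qed.

Lemma dfund_bound s : s0 <= s -> `|dfund s| <= A.
Proof.
move=> ss; have sp : 0 < s := lt_le_trans s00 ss.
rewrite /dfund powR_half// normrM normrN (gtr0_norm fund_const_gt0).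
rewrite -[leRHS]/(kappa * r ^- n) ler_wpM2l ?(ltW fund_const_gt0)//.
rewrite ger0_norm; last by rewrite invr_ge0 exprn_ge0 ?sqrtr_ge0.
rewrite lef_pV2 ?posrE ?exprn_gt0 ?sqrtr_gt0// lerXn2r ?nnegrE ?sqrtr_ge0 ?(ltW r0)//.
by rewrite -sqrts0 ler_wsqrtr.
Qed.

Lemma sqrt_dfund_bound s : s0 <= s -> Num.sqrt s * `|dfund s| <= r * A.
Proof.
move=> ss; have sp : 0 < s := lt_le_trans s00 ss.
have tp : 0 < Num.sqrt s by rewrite sqrtr_gt0.
have tn k : 0 < Num.sqrt s ^+ k by rewrite exprn_gt0.
rewrite /dfund powR_half// normrM normrN (gtr0_norm fund_const_gt0).
rewrite [X in kappa * X]gtr0_norm ?invr_gt0//.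
have -> : Num.sqrt s * (kappa * Num.sqrt s ^- n) = kappa * Num.sqrt s ^- m.
  by rewrite /n exprS; field; rewrite !gt_eqF.
have -> : r * A = kappa * r ^- m.
  by rewrite /slope /n exprS; field; rewrite !gt_eqF ?exprn_gt0.
rewrite ler_wpM2l ?(ltW fund_const_gt0)//.
rewrite lef_pV2 ?posrE ?exprn_gt0// lerXn2r ?nnegrE ?sqrtr_ge0 ?(ltW r0)//.
by rewrite -sqrts0 ler_wsqrtr.
Qed.

Let dcap_out s : s0 < s -> dcap s = dfund s.
Proof. by move=> ss; rewrite /dcap ifN// -ltNge. Qed.

Lemma dcap_lin s : s <= s0 -> dcap s = - (A * (1 + p * (1 - s / s0))).
Proof.
move=> ss; rewrite /dcap ss dfund_s0 ddfund_s0.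
by field; rewrite gt_eqF.
Qed.

Let dcap_lin_bound s : 0 <= s -> s <= s0 -> `|dcap s| <= A * (1 + p).
Proof.
move=> sp ss; rewrite dcap_lin// normrN.
have q0 : 0 <= s / s0 by rewrite divr_ge0// ltW.
have q1 : s / s0 <= 1 by rewrite ler_pdivrMr// mul1r.
rewrite ger0_norm; last first.
  by rewrite mulr_ge0 ?(ltW slope_gt0)// addr_ge0// mulr_ge0 ?(ltW p0)// subr_ge0.
rewrite ler_wpM2l ?(ltW slope_gt0)// lerD2l ler_piMr ?(ltW p0)//.
by rewrite gerBl.
Qed.

Definition cap_bound : R := A * (1 + p) * (1 + r).

Let cap_bound_ge x : x <= A * (1 + p) -> x <= cap_bound.
Proof.
move=> h; rewrite (le_trans h)// ler_peMr ?lerDl ?ltW//.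
by rewrite mulr_gt0 ?slope_gt0// addr_gt0.
Qed.

Let A_le : A <= A * (1 + p).
Proof. by rewrite ler_peMr ?lerDl ?ltW ?slope_gt0. Qed.

Lemma dcap_bound s : 0 <= s -> `|dcap s| <= cap_bound.
Proof.
move=> sp; apply: cap_bound_ge; have [ss|ss] := leP s s0; first exact: dcap_lin_bound.
by rewrite dcap_out// (le_trans _ A_le)// dfund_bound// ltW.
Qed.

Lemma sqrt_dcap_bound s : 0 <= s -> Num.sqrt s * `|dcap s| <= cap_bound.
Proof.
move=> sp; rewrite (@le_trans _ _ (r * (A * (1 + p))))//.
  have [ss|ss] := leP s s0.
    rewrite ler_pM ?sqrtr_ge0 ?dcap_lin_bound//.
    by rewrite -sqrts0 ler_wsqrtr.
  rewrite dcap_out// (le_trans (sqrt_dfund_bound (ltW ss)))//.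
  by rewrite ler_wpM2l// ltW.
by rewrite mulrC ler_wpM2l ?lerDr// mulr_ge0 ?(ltW slope_gt0)// addr_ge0// ltW.
Qed.

Lemma ddcap_bound s : 0 <= s -> s * `|ddcap s| <= cap_bound.
Proof.
move=> sp; apply: cap_bound_ge.
have Ap : A * p <= A * (1 + p) by rewrite ler_wpM2l ?(ltW slope_gt0)// lerDr.
have [ss|ss] := leP s s0; rewrite /ddcap.
  rewrite (max_idPr ss) ddfund_s0 ger0_norm; last first.
    by apply: divr_ge0; [apply: mulr_ge0; apply: ltW => //; exact: slope_gt0|exact: ltW].
  rewrite (le_trans _ Ap)// (_ : s * _ = A * p * (s / s0)); last by ring.
  apply: ler_piMr; last by rewrite ler_pdivrMr// mul1r.
  by apply: mulr_ge0; apply: ltW => //; exact: slope_gt0.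
rewrite (max_idPl (ltW ss)); have sp' := lt_trans s00 ss.
have -> : s * `|ddfund s| = `|dfund s| * p.
  rewrite ddfundE// -{1}(gtr0_norm sp') -normrM -{2}(gtr0_norm p0) -normrM -[RHS]normrN.
  by congr `|_|; field; rewrite gt_eqF.
rewrite (le_trans _ Ap)// ler_wpM2r ?(ltW p0)//.
by apply: dfund_bound; exact: ltW.
Qed.

(** The left-hand side is - Delta (cap(|x|^2)) at |x|^2 = s, in dimension n. It vanishes
    outside the ball of radius r, where the fundamental solution is harmonic, and it is an
    inverted paraboloid inside. *)
Lemma cap_laplacian s :
  - (2 * n%:R * dcap s + 4 * s * ddcap s) =
  w^-1 * r ^- n * (1 + p) * Num.max 0 (1 - s / s0).
Proof.
have wn := w0; have rn : 0 < r ^+ n by exact: exprn_gt0.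
have nE : n%:R = 2 * p :> R by rewrite /p mulrC divfK.
have AE : A = (4 * p * w)^-1 * r ^- n.
  by rewrite /slope /fund_const nE mulrA; congr (((_ * _) * _)^-1 * _); ring.
have [ss|ss] := leP s s0.
  rewrite dcap_lin// /ddcap (max_idPr ss) ddfund_s0 nE.
  rewrite (max_idPr _); last by rewrite subr_ge0 ler_pdivrMr// mul1r.
  by rewrite AE; field; rewrite !gt_eqF.
have sp : 0 < s := lt_trans s00 ss.
rewrite (max_idPl _); last by rewrite subr_le0 ler_pdivlMr// mul1r ltW.
rewrite mulr0 /ddcap (max_idPl (ltW ss)) ddfundE// dcap_out// nE.
by field; rewrite gt_eqF.
Qed.

(** The mean value theorem has to be used in the variable t = |x|: the derivative is then
    - 2 kappa t^(1-n), which is locally integrable in R^n, while in the variable t^2 it would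
    only give the non-integrable t^(-n). *)
Lemma fund_diff t : 0 < t <= r -> `|fund (t ^+ 2) - fund s0| <= 2 * kappa * r * t ^- m.
Proof.
move=> /andP[t0 tr].
have dsq (u : R) : 0 < u ->
    is_derive u 1 (fund \o (fun u => u ^+ 2)) (- 2 * kappa * u ^- m).
  move=> u0.
  have d2 : is_derive u 1 ((@idfun R) ^+ 2) ((2%:R * u ^+ 1) *: 1) by exact: is_deriveX.
  have -> : - 2 * kappa * u ^- m = dfund (u ^+ 2) * ((2%:R * u ^+ 1) *: 1).
    rewrite /dfund powR_half ?exprn_gt0// sqrtr_sqr gtr0_norm// /GRing.scale/=.
    by rewrite /n exprS; field; rewrite gt_eqF ?exprn_gt0//= gt_eqF.
  apply: is_derive1_comp; apply: is_derive_fund.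
  by rewrite exprn_gt0.
have [c /andP[tc cr] e] : exists2 c, c \in `[t, r] &
    (fund \o (fun u => u ^+ 2)) r - (fund \o (fun u => u ^+ 2)) t =
    (- 2 * kappa * c ^- m) * (r - t).
  apply: (@MVT_segment _ _ (fun c => - 2 * kappa * c ^- m)) => //.
    move=> c; rewrite in_itv/= => /andP[tc _]; apply: dsq; exact: (lt_trans t0 tc).
  apply: continuous_in_subspaceT => c; rewrite inE/= in_itv/= => /andP[tc _].
  by apply: is_derive_continuous (dsq c _); exact: (lt_le_trans t0 tc).
have c0 : 0 < c := lt_le_trans t0 tc.
have e' : fund s0 - fund (t ^+ 2) = - 2 * kappa * c ^- m * (r - t) by exact: e.
rewrite distrC e' normrM mulNr mulNr normrN normrM (@gtr0_norm _ (2 * kappa)); last first.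
  by rewrite mulr_gt0// fund_const_gt0.
rewrite -mulrA -[leRHS]mulrA ler_wpM2l//; first by rewrite mulr_ge0// (ltW fund_const_gt0).
rewrite [leRHS]mulrC ler_pM//.
  rewrite gtr0_norm ?invr_gt0 ?exprn_gt0//.
  by rewrite lef_pV2 ?posrE ?exprn_gt0// lerXn2r// nnegrE ltW.
by rewrite ger0_norm ?subr_ge0// gerBl ltW.
Qed.

Lemma cap_diff s : 0 <= s <= s0 -> `|cap s - fund s0| <= kappa * (1 + p) * r ^- m * r.
Proof.
move=> /andP[sp ss]; rewrite /cap ss dfund_s0 ddfund_s0.
have -> : fund s0 + - A * (s - s0) + A * p / s0 / 2 * (s - s0) ^+ 2 - fund s0 =
   A * (s0 - s) * (1 + p / 2 * (1 - s / s0)) by field; rewrite gt_eqF.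
have q0 : 0 <= s / s0 by rewrite divr_ge0// ltW.
have q1 : s / s0 <= 1 by rewrite ler_pdivrMr// mul1r.
have A0 := ltW slope_gt0.
rewrite ger0_norm; last first.
  apply: mulr_ge0; first by rewrite mulr_ge0 ?subr_ge0.
  by rewrite addr_ge0// !mulr_ge0 ?subr_ge0// (ltW p0).
have -> : kappa * (1 + p) * r ^- m * r = A * s0 * (1 + p).
  by rewrite /slope /s0 /n exprS; field; rewrite !gt_eqF ?exprn_gt0.
apply: ler_pM.
- by rewrite mulr_ge0 ?subr_ge0.
- by apply: addr_ge0 => //; rewrite !mulr_ge0 ?subr_ge0// (ltW p0).
- by rewrite ler_wpM2l// gerBl.
- rewrite lerD2l -[leRHS]mulr1 ler_pM ?subr_ge0// ?gerBl//.
    by rewrite mulr_ge0// (ltW p0).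
  by rewrite ler_piMr ?(ltW p0)// invf_le1// ler1n.
Qed.

End profile.

(** * The Poisson equation *)

Section Ck_linear.
Context {R : realType} (n : nat).
Local Notation E := 'rV[R]_n.
Local Notation e_ i := (delta_mx ord0 i : 'rV[R]_n).
Variables (s t : R).

Definition lin (f g : E -> R) : E -> R := fun x => s * f x + t * g x.

Lemma continuous_lin (f g : E -> R) : continuous f -> continuous g -> continuous (lin f g).
Proof.
move=> cf cg x.
apply: (@continuousD _ _ _ (fun x => s * f x) (fun x => t * g x)).
  by apply: (@continuousM _ _ (cst s) f); [exact: cst_continuous|exact: cf].
by apply: (@continuousM _ _ (cst t) g); [exact: cst_continuous|exact: cg].
Qed.

Lemma is_derive_lin (f g : E -> R) (x v : E) : derivable f x v -> derivable g x v ->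
  is_derive x v (lin f g) (s * 'D_v f x + t * 'D_v g x).
Proof.
move=> df dg.
have Df : is_derive x v f ('D_v f x) by split.
have Dg : is_derive x v g ('D_v g x) by split.
exact: (is_deriveD (is_deriveZ s Df) (is_deriveZ t Dg)).
Qed.

Lemma partial_lin i (f g : E -> R) : (forall x, derivable f x (e_ i)) ->
  (forall x, derivable g x (e_ i)) ->
  partial i (lin f g) = lin (partial i f) (partial i g).
Proof.
move=> df dg; apply/funext => x; rewrite /partial.
by have := is_derive_lin (df x) (dg x) => ?; rewrite derive_val.
Qed.

Lemma Ck_lin k (f g : E -> R) : Ck k f -> Ck k g -> Ck k (lin f g).
Proof.
elim: k f g => [|k IH] f g /= [cf Cf] [cg Cg]; split; try exact: continuous_lin.
  by [].
move=> i; have [df Cdf] := Cf i; have [dg Cdg] := Cg i; split.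
  by move=> x; case: (is_derive_lin (df x) (dg x)).
by rewrite (partial_lin df dg); exact: IH.
Qed.

Lemma laplacian_lin (f g : E -> R) : Ck 2 f -> Ck 2 g ->
  laplacian (lin f g) = lin (laplacian f) (laplacian g).
Proof.
move=> [_ Cf] [_ Cg]; apply/funext => x; rewrite [RHS]/lin /laplacian !mulr_sumr -big_split/=.
apply: eq_bigr => i _; have [df [_ /(_ i)[ddf _]]] := Cf i.
have [dg [_ /(_ i)[ddg _]]] := Cg i.
by rewrite (partial_lin df dg) (partial_lin ddf ddg).
Qed.

End Ck_linear.

Section kernel_estimate.
Context {R : realType} (n : nat).
Local Notation E := 'rV[R]_n.
Local Notation leb := (@lebesgue_rV R n).

Lemma conv_cpt_le (K : E -> R) (r M : R) (b : E -> R) (x : E) :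
  leb.-integrable setT (EFin \o K) -> (forall y, r < `|y| -> K y = 0) ->
  continuous b -> (forall z, `|z - x| <= r -> `|b z| <= M) ->
  `|conv K b x| <= M * \int[leb]_y `|K y|.
Proof.
move=> intK suppK cb bM.
have intKb := integrable_conv_cpt intK suppK x cb.
have intnK := integrable_norm intK.
rewrite convC//.
apply: (le_trans (le_normr_Rintegral measurableT intKb)).
rewrite -RintegralZl//; apply: le_Rintegral => //.
- exact: (integrable_norm intKb).
- by rewrite /comp; under eq_fun do rewrite EFinM; apply: integrableZl.
move=> y _; rewrite normrM.
have [ry|yr] := ltP r `|y|; first by rewrite suppK// normr0 mul0r mulr0.
by rewrite mulrC ler_wpM2r// bM// addrAC subrr add0r normrN.
Qed.

End kernel_estimate.

Section poisson.
Context {R : realType} (m : nat).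
Let n := m.+1.
Local Notation E := 'rV[R]_n.
Local Notation leb := (@lebesgue_rV R n).
Local Notation e_ i := (delta_mx ord0 i : 'rV[R]_n).
Let w : R := @unit_ball_volume R n.
Let w0 : 0 < w. Proof. exact: unit_ball_volume_gt0. Qed.
Let p : R := n%:R / 2.
Let p0 : 0 < p. Proof. by rewrite divr_gt0. Qed.
Local Notation kappa := (@fund_const R m).
Let k0 : 0 < kappa. Proof. exact: fund_const_gt0. Qed.

(** The part of the fundamental solution that the cap removes. It lives in the ball of
    radius r and has a small integral. *)
Definition sing (r : R) (y : E) : R := Phi y - cap m r (sqn y).

Lemma sing_supp r y : 0 < r -> r < `|y| -> sing r y = 0.
Proof.
move=> r0 ry; rewrite /sing PhiE /cap ifF ?subrr//.
apply/negbTE; rewrite -ltNge -sqr_enorm ltrXn2r// ?nnegrE ?enorm_ge0 ?ltW//.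
by rewrite (lt_le_trans ry)// norm_le_enorm.
Qed.

Lemma measurable_Phi : measurable_fun setT (@Phi R n).
Proof.
have ms := @measurable_enorm R n.
rewrite /Phi /n; move: ms; rewrite /n; case: m => [|[|k]] ms.
- apply: measurableT_comp => //; exact: measurable_funM.
- apply: measurableT_comp => //; apply: measurable_funM => //.
  exact: measurableT_comp.
- apply: measurable_funM => //.
  rewrite (_ : (fun x => _) = (fun x : 'rV[R]_k.+3 => enorm x `^ (- (k.+3 - 2)%:R))).
    by apply: (measurableT_comp (measurable_powR _)).
  by apply/funext => x; rewrite powR_invn// enorm_ge0.
Qed.

Lemma continuous_capsqn r : 0 < r -> continuous (fun y : E => cap m r (sqn y)).
Proof.
move=> r0; apply: continuous_radial => s.
exact: is_derive_continuous (is_derive_cap m r0 s).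
Qed.

Lemma measurable_sing r : 0 < r -> measurable_fun setT (sing r).
Proof.
move=> r0; apply: measurable_funB; first exact: measurable_Phi.
exact: (continuous_measurable_rV (continuous_capsqn r0)).
Qed.

Lemma sing_bound r y : 0 < r -> 0 < enorm y <= r ->
  `|sing r y| <= kappa * (3 + p) * r * enorm y ^- m.
Proof.
move=> r0 /andP[t0 tr]; rewrite /sing PhiE.
have -> : fund m (sqn y) - cap m r (sqn y) =
  (fund m (enorm y ^+ 2) - fund m (r ^+ 2)) - (cap m r (sqn y) - fund m (r ^+ 2)).
  by rewrite sqr_enorm; ring.
rewrite (le_trans (ler_normB _ _))//.
have -> : kappa * (3 + p) * r * enorm y ^- m =
  2 * kappa * r * enorm y ^- m + kappa * (1 + p) * enorm y ^- m * r by ring.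
apply: lerD; first by apply: fund_diff; rewrite ?t0.
apply: le_trans (cap_diff m r0 _) _.
  by rewrite sqn_ge0/= -sqr_enorm lerXn2r// nnegrE ltW.
rewrite ler_wpM2r ?(ltW r0)// ler_wpM2l//.
  by rewrite mulr_ge0 ?(ltW k0)// addr_ge0// ltW.
by rewrite lef_pV2 ?posrE ?exprn_gt0// lerXn2r// nnegrE ltW.
Qed.

Lemma lebesgue_origin : leb [set y | enorm y <= 0] = 0%E.
Proof.
apply/eqP; rewrite -measure_le0; apply/lee_addgt0Pr => e e0; rewrite add0e.
pose r := Num.min 1 (e / w).
have r0 : 0 < r by rewrite lt_min ltr01 divr_gt0.
have mB c : measurable [set x : E | enorm x <= c].
  exact: (measurable_le_rV _ (@enorm_continuous R n)).
rewrite (@le_trans _ _ (leb [set y | enorm y <= r]))//.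
  apply: le_measure; rewrite ?inE// => y /= h; rewrite (le_trans h)// ltW//.
rewrite lebesgue_ball// lee_fin (@le_trans _ _ (r * w))//.
  rewrite ler_wpM2r ?(ltW w0)// exprS ler_piMr ?(ltW r0)//.
  by rewrite exprn_ile1 ?(ltW r0)// ge_min lexx.
by rewrite -ler_pdivlMr// ge_min lexx orbT.
Qed.

Let J : R := fine (\int[leb]_(x in [set x | enorm x <= 1]%R) (enorm x `^ (1 - n%:R))%:E)%E.

(** The bound C r |y|^(1-n) may fail at the origin, where Phi has an arbitrary value, hence
    the detour through almost every y. *)
Lemma integral_sing r : 0 < r <= 1 ->
  leb.-integrable setT (EFin \o sing r) /\
  \int[leb]_y `|sing r y| <= kappa * (3 + p) * J * r.
Proof.
move=> /andP[r0 r1].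
have mB c : measurable [set x : E | enorm x <= c].
  exact: (measurable_le_rV _ (@enorm_continuous R n)).
have C0 : 0 <= kappa * (3 + p) * r.
  by rewrite !mulr_ge0 ?(ltW k0) ?(ltW r0)// addr_ge0// ltW.
have mp : measurable_fun setT (fun x : E => enorm x `^ (1 - n%:R)).
  apply: (measurableT_comp (measurable_powR _)); exact: measurable_enorm.
have JE : (\int[leb]_(x in [set x | enorm x <= 1]%R) (enorm x `^ (1 - n%:R))%:E = J%:E)%E.
  rewrite fineK// ge0_fin_numE; first exact: integral_weak_singularity.
  by apply: integral_ge0 => x _; rewrite lee_fin powR_ge0.
have key : (\int[leb]_y `|(sing r y)%:E| <= (kappa * (3 + p) * J * r)%:E)%E.
  have -> : (kappa * (3 + p) * J * r)%:E = (\int[leb]_y ((kappa * (3 + p) * r)%:E *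
     ((fun x => (enorm x `^ (1 - n%:R))%:E) \_ [set x | enorm x <= 1]%R) y))%E.
    rewrite ge0_integralZl//.
    - by rewrite -integral_mkcond JE -EFinM; congr (_%:E); ring.
    - apply/(measurable_restrictT _ (mB 1)) => //.
      by apply: measurable_funTS; apply/measurable_EFinP.
    - by move=> y _; rewrite patchE; case: ifP => // _; rewrite lee_fin powR_ge0.
  apply: ae_ge0_le_integral => //.
  - by apply: measurableT_comp => //; apply/measurable_EFinP; exact: measurable_sing.
  - move=> y _; apply: mule_ge0; first by rewrite lee_fin.
    by rewrite patchE; case: ifP => // _; rewrite lee_fin powR_ge0.
  - apply: emeasurable_funM => //.
    apply/(measurable_restrictT _ (mB 1)) => //.
    by apply: measurable_funTS; apply/measurable_EFinP.
  exists [set y | enorm y <= 0]; split; [exact: mB|exact: lebesgue_origin|].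
  move=> y /= /not_implyP[_ h]; rewrite leNgt; apply/negP => y0; apply: h.
  rewrite patchE; have [yr|ry] := leP (enorm y) r.
    rewrite mem_set/=; last exact: le_trans yr r1.
    rewrite -EFinM lee_fin (le_trans (sing_bound r0 _)) ?y0//.
    rewrite ler_wpM2l// (_ : 1 - n%:R = - m%:R); last by rewrite /n -natr1; ring.
    by rewrite powR_invn// ltW.
  rewrite (_ : sing r y = 0).
    rewrite normr0 mule_ge0 ?lee_fin//; case: ifP => // _; by rewrite lee_fin powR_ge0.
  rewrite /sing PhiE /cap ifF ?subrr//.
  by apply/negbTE; rewrite -ltNge -sqr_enorm ltrXn2r// ?nnegrE ?ltW.
have intS : leb.-integrable setT (EFin \o sing r).
  apply/integrableP; split; first by apply/measurable_EFinP; exact: measurable_sing.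
  by apply: le_lt_trans key _; rewrite ltry.
split => //; rewrite -lee_fin fineK//.
by apply: integrable_fin_num => //; exact: (integrable_norm intS).
Qed.

(** Minus the Laplacian of the capped fundamental solution, an approximate identity. *)
Definition mollifier (r : R) (x : E) : R :=
  w^-1 * r ^- n * (1 + p) * Num.max 0 (1 - sqn x / r ^+ 2).

Let moll_const r : 0 < r -> 0 < w^-1 * r ^- n * (1 + p).
Proof. by move=> r0; rewrite !mulr_gt0 ?invr_gt0 ?exprn_gt0// addr_gt0. Qed.

Lemma mollifier_ge0 r x : 0 < r -> 0 <= mollifier r x.
Proof. by move=> r0; rewrite mulr_ge0 ?(ltW (moll_const r0))// le_max lexx. Qed.

Lemma mollifier_supp r y : 0 < r -> r < `|y| -> mollifier r y = 0.
Proof.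
move=> r0 ry; rewrite /mollifier (max_idPl _) ?mulr0// subr_le0.
rewrite ler_pdivlMr ?exprn_gt0// mul1r -sqr_enorm lerXn2r// ?nnegrE ?enorm_ge0 ?ltW//.
by rewrite (lt_le_trans ry)// norm_le_enorm.
Qed.

Lemma integral_mollifier r : 0 < r -> (\int[leb]_x (mollifier r x)%:E = 1)%E.
Proof.
move=> r0.
have mq : measurable_fun setT (fun x : E => (Num.max 0 (1 - sqn x / r ^+ 2))%:E).
  apply/measurable_EFinP; apply: measurable_maxr => //; apply: measurable_funB => //.
  apply: measurable_funM => //.
  exact: (continuous_measurable_rV (@sqn_continuous R n)).
have q0 (x : E) : (0 <= (Num.max 0 (1 - sqn x / r ^+ 2))%:E)%E.
  by rewrite lee_fin le_max lexx.
rewrite /mollifier; under eq_integral do rewrite EFinM.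
rewrite ge0_integralZl//; last by rewrite lee_fin (ltW (moll_const r0)).
rewrite -(@ge0_integral_affine _ _ 0 r)//; last by rewrite gt_eqF.
rewrite (_ : (\int[leb]_x _)%E = (2 * w / (n%:R + 2))%:E); last first.
  rewrite -integral_paraboloid//; apply: eq_integral => x _.
  rewrite add0r -sqr_enorm enormZ exprMn gtr0_norm// mulrAC divff ?mul1r//.
  by rewrite gt_eqF ?exprn_gt0.
rewrite gtr0_norm// -!EFinM; congr (_%:E); rewrite /p.
have n2 : n%:R + 2 != 0 :> R by rewrite -natrD pnatr_eq0.
by field; rewrite n2 !gt_eqF ?exprn_gt0.
Qed.

Lemma integrable_mollifier r : 0 < r -> leb.-integrable setT (EFin \o mollifier r).
Proof.
move=> r0; apply/integrableP; split.
  apply/measurable_EFinP; apply: measurable_funM => //.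
  apply: measurable_maxr => //; apply: measurable_funB => //; apply: measurable_funM => //.
  exact: (continuous_measurable_rV (@sqn_continuous R n)).
rewrite (eq_integral (fun x => (mollifier r x)%:E)); first by rewrite integral_mollifier ?ltry.
by move=> x _; rewrite /= ger0_norm// mollifier_ge0.
Qed.

Let conv_mollifier_near (r eps : R) (b : E -> R) (x : E) : 0 < r -> continuous b ->
  (forall z, `|z - x| <= r -> `|b z - b x| <= eps) ->
  `|conv (mollifier r) b x - b x| <= eps.
Proof.
move=> r0 cb hb.
have iM := integrable_mollifier r0.
have sM y := @mollifier_supp r y r0.
have M1 : \int[leb]_y mollifier r y = 1 by rewrite /Rintegral integral_mollifier.
have cb' : continuous (fun z => b z - b x).
  move=> z; apply: (@continuousB _ _ _ b (cst (b x))); [exact: cb|exact: cst_continuous].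
have i1 := integrable_conv_cpt iM sM x cb.
have i2 := integrable_conv_cpt iM sM x cb'.
have -> : conv (mollifier r) b x - b x = conv (mollifier r) (fun z => b z - b x) x.
  rewrite (convC i1) (convC i2).
  rewrite -[X in _ - X]mul1r -{1}M1 -RintegralZr// -RintegralB//.
  - by apply: eq_Rintegral => y _; rewrite mulrBr.
  - by rewrite /comp; under eq_fun do rewrite EFinM; exact: integrableZr.
rewrite (le_trans (conv_cpt_le iM sM cb' hb))//.
rewrite (_ : \int[leb]_y _ = 1) ?mulr1// -[RHS]M1.
by apply: eq_Rintegral => y _; rewrite ger0_norm// mollifier_ge0.
Qed.

Variable a : E -> R.
Hypothesis inta : leb.-integrable setT (EFin \o a).
Hypothesis Ca : Ck 2 a.

Let ca : continuous a. Proof. by case: Ca. Qed.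

Let cap1 r := @radial1 R n (dcap m r).
Let cap2 r := @radial2 R n (dcap m r) (ddcap m r).
Let capM r : R := (2 * n%:R + 6) * cap_bound m r.

Lemma cap_bound_ge0 (r : R) : 0 < r -> 0 <= cap_bound m r.
Proof. by move=> r0; rewrite (le_trans _ (@dcap_bound R m r r0 0 (lexx 0))). Qed.

Let capM_osc r : 0 < r -> forall (x z : E), `|z| <= 1 ->
  `|cap m r (sqn (x + z)) - cap m r (sqn x)| <= capM r.
Proof.
move=> r0 x z z1.
apply: (le_trans (radial_osc (is_derive_cap m r0) (sqrt_dcap_bound m r0) x z)).
rewrite /capM (@le_trans _ _ (2 * n%:R * cap_bound m r))//.
  by rewrite ler_piMr// mulr_ge0 ?cap_bound_ge0.
by rewrite ler_wpM2r ?cap_bound_ge0// lerDl.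
Qed.

Let capM_1 r : 0 < r -> forall i x, `|cap1 r i x| <= capM r.
Proof.
move=> r0 i x; apply: (le_trans (radial1_bound (sqrt_dcap_bound m r0) i x)).
rewrite ler_wpM2r ?cap_bound_ge0//.
by have : 1 <= n%:R :> R; [rewrite ler1n|lra].
Qed.

Let capM_2 r : 0 < r -> forall i j x, `|cap2 r i j x| <= capM r.
Proof.
move=> r0 i j x.
apply: (le_trans (radial2_bound (dcap_bound m r0) (ddcap_bound m r0) i j x)).
by rewrite ler_wpM2r ?cap_bound_ge0// lerDr mulr_ge0.
Qed.

(** The singular part is harmless everywhere since a is locally bounded, and the capped
    kernel changes by a bounded amount when its argument is translated by x - x0. So absolute
    convergence of Phi * a at a single point propagates to all points. *)
Lemma Phi_conv_defined_from (x0 : E) :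
  leb.-integrable setT (fun y => (Phi (x0 - y) * a y)%:E) -> Phi_conv_defined a.
Proof.
move=> ix0 x.
have r01 : is_true (((0 : R) < 1) && ((1 : R) <= 1)) by rewrite ltr01 lexx.
have [iS _] := integral_sing r01.
have sS y := @sing_supp 1 y ltr01.
have iK z := integrable_conv_cpt' iS sS z ca.
have iG0 : leb.-integrable setT (fun y => (cap m 1 (sqn (x0 - y)) * a y)%:E).
  apply: eq_integrable (integrableB measurableT ix0 (iK x0)) => //.
  by move=> y _; rewrite /= -EFinB; congr (_%:E); rewrite /sing -mulrBl subKr.
have ma : measurable_fun setT a by apply/measurable_EFinP; exact: measurable_int inta.
pose C := 2 * n%:R * cap_bound m 1 * `|x - x0|.
have osc y : `|cap m 1 (sqn (x - y)) - cap m 1 (sqn (x0 - y))| <= C.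
  have -> : x - y = (x0 - y) + (x - x0) by rewrite [RHS]addrC addrA subrK.
  exact: (@radial_osc R n _ _ (@is_derive_cap R m 1 ltr01) _
    (@sqrt_dcap_bound R m 1 ltr01) (x0 - y) (x - x0)).
have iG : leb.-integrable setT (fun y => (cap m 1 (sqn (x - y)) * a y)%:E).
  apply: (@le_integrable _ _ _ leb setT measurableT _
    (fun y => (`|cap m 1 (sqn (x0 - y)) * a y| + C * `|a y|)%:E)).
  - apply/measurable_EFinP; apply: measurable_funM => //.
    exact: (continuous_measurable_rV (@continuous_shift R n _ x (continuous_capsqn ltr01))).
  - move=> y _; rewrite !abse_EFin lee_fin (le_trans _ (ler_norm _))//.
    rewrite -(subrK (cap m 1 (sqn (x0 - y))) (cap m 1 (sqn (x - y)))) mulrDl addrC.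
    by rewrite (le_trans (ler_normD _ _))// lerD// normrM ler_wpM2r.
  - under eq_fun do rewrite EFinD; apply: integrableD => //.
      exact: (integrable_norm iG0).
    under eq_fun do rewrite EFinM; apply: integrableZl => //.
    exact: (integrable_norm inta).
apply: eq_integrable (integrableD measurableT iG (iK x)) => //.
by move=> y _; rewrite /= -EFinD; congr (_%:E); rewrite /sing -mulrDl addrC subrK.
Qed.

Hypothesis Pa : Phi_conv_defined a.

(** Phi is the sum of a C^2 kernel with bounded derivatives and an integrable compactly
    supported one. Derivatives of the convolution fall on the first kernel and, in the
    second term, on a. *)
Let split_Phi r : 0 < r <= 1 ->
  [/\ Ck 2 (Phi_conv a) & forall x, - laplacian (Phi_conv a) x =
     conv (mollifier r) a x - conv (sing r) (laplacian a) x].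
Proof.
move=> /[dup] r01 /andP[r0 r1].
have [iS _] := integral_sing r01.
have sS y := @sing_supp r y r0.
have iK z := integrable_conv_cpt' iS sS z ca.
pose G (y : E) := cap m r (sqn y).
have iG x : leb.-integrable setT (fun y => (G (x - y) * a y)%:E).
  apply: eq_integrable (integrableB measurableT (Pa x) (iK x)) => //.
  by move=> y _; rewrite /= -EFinB; congr (_%:E); rewrite /sing -mulrBl subKr.
have dG := @is_derive_radial1 R n _ _ (is_derive_cap m r0).
have dG1 := @is_derive_radial2 R n _ _ (is_derive_dcap m r0).
have cG1 := @continuous_radial1 R n _ _ (is_derive_dcap m r0).
have cG2 := @continuous_radial2 R n _ _ (is_derive_dcap m r0) (@continuous_ddcap R m r r0).
have cG : continuous G := continuous_capsqn r0.
have C1 := Ck2_conv inta cG (capM_osc r0) dG dG1 cG1 cG2 (capM_1 r0) (capM_2 r0) iG.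
have L1 := laplacian_conv inta dG dG1 cG1 cG2 (capM_1 r0) (capM_2 r0) iG.
have C2 := Ck_conv_cpt iS sS Ca.
have L2 := laplacian_conv_cpt iS sS Ca.
have E : Phi_conv a = lin 1 1 (conv G a) (conv (sing r) a).
  apply/funext => x; rewrite /lin !mul1r /conv -(RintegralD measurableT (iG x) (iK x)).
  by apply: eq_Rintegral => y _; rewrite -mulrDl; congr (_ * _); rewrite [RHS]addrC subrK.
split; first by rewrite E; exact: Ck_lin.
move=> x; rewrite E (laplacian_lin 1 1 C1 C2) L1 L2 /lin !mul1r opprD; congr (_ - _).
have ih : leb.-integrable setT (fun y => ((\sum_i cap2 r i i (x - y)) * a y)%:E).
  apply: (@integrable_conv_bounded R n a inta (fun x => \sum_i cap2 r i i x) (n%:R * capM r)).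
    by move=> z; apply: (@cvg_sumr _ _ _ _ (nbhs_filter z)) => i; exact: cG2.
  move=> y; rewrite (le_trans (ler_norm_sum _ _ _))//.
  apply: (@le_trans _ _ (\sum_(i < n) capM r)); last by rewrite sumr_const card_ord mulr_natl.
  by apply: ler_sum => i _; exact: capM_2.
rewrite /conv -mulN1r -RintegralZl//; apply: eq_Rintegral => y _.
rewrite mulrA mulN1r; congr (_ * _).
rewrite /mollifier -cap_laplacian//; congr (- _).
rewrite /radial2 big_split/=; congr (_ + _).
  rewrite -mulr_suml -mulr_sumr; congr (_ * _ * _).
  by under eq_bigr do rewrite eqxx; rewrite sumr_const card_ord.
rewrite -mulr_suml /sqn mulr_sumr; congr (_ * _).
by apply: eq_bigr => i _; rewrite expr2 mulrA.
Qed.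

(** The identity of split_Phi holds for every r while its left-hand side does not depend
    on r. As r tends to 0 the mollified a converges to a and the other term is O(r). *)
Theorem poisson : Ck 2 (Phi_conv a) /\ forall x, - laplacian (Phi_conv a) x = a x.
Proof.
have r01 : is_true (((0 : R) < 1) && ((1 : R) <= 1)) by rewrite ltr01 lexx.
split; first by have [] := split_Phi r01.
move=> x; apply/eqP; rewrite -subr_eq0 -normr_le0; apply/ler_addgt0Pr => e e0; rewrite add0r.
have cL : continuous (laplacian a).
  move=> z; apply: (@cvg_sumr _ _ _ _ (nbhs_filter z)) => i.
  by case: Ca => _ /(_ i)[_ [_ /(_ i)[_ [h _]]]]; exact: h.
have [M M0 hM] := continuous_bounded_ball x 1 cL.
have /cvgrPdist_lt/(_ _ (divr_gt0 e0 (ltr0n R 2))) : {for x, continuous a} := @ca x.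
move=> /nbhs_ballP[dl /= dl0 hd].
pose C := M * (kappa * (3 + p) * J).
have J0 : 0 <= J.
  by rewrite fine_ge0// integral_ge0// => y _; rewrite lee_fin powR_ge0.
have C0 : 0 <= C by rewrite !mulr_ge0// ?(ltW k0)// addr_ge0// ltW.
(* The second bound makes a oscillate by at most e / 2 on the ball of radius r, the third
   makes the singular term at most e / 2. *)
pose r := Num.min 1 (Num.min (dl / 2) (e / 2 / (C + 1))).
have C1 : 0 < C + 1 by rewrite ltr_wpDl.
have r0 : 0 < r by rewrite !lt_min ltr01 !divr_gt0.
have r1 : r <= 1 by rewrite ge_min lexx.
have r01' : 0 < r <= 1 by rewrite r0.
have rdl : r < dl.
  rewrite (@le_lt_trans _ _ (dl / 2))//; first by rewrite !ge_min lexx !orbT.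
  by rewrite ltr_pdivrMr// ltr_pMr// ltr1n.
have rC : C * r <= e / 2.
  rewrite (@le_trans _ _ ((C + 1) * r))//; first by rewrite ler_wpM2r ?(ltW r0)// lerDl.
  by rewrite mulrC -ler_pdivlMr// !ge_min lexx !orbT.
have [_ /(_ x) ->] := split_Phi r01'.
have [iS hS] := integral_sing r01'.
have sS y := @sing_supp r y r0.
rewrite addrAC (le_trans (ler_normB _ _))// (splitr e); apply: lerD.
  apply: conv_mollifier_near => // z zx; rewrite ltW// distrC; apply: hd.
  by rewrite -ball_normE/= distrC (le_lt_trans zx).
rewrite (le_trans (@conv_cpt_le R n (sing r) r M _ x iS sS cL _))//.
  by move=> z zr; apply: hM; exact: le_trans zr r1.
have CE : C * r = M * (kappa * (3 + p) * J * r) by rewrite /C [RHS]mulrA.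
by rewrite (le_trans _ rC)// CE ler_wpM2l.
Qed.

End poisson.

(** * Curves of densities *)

Section constant_velocity.
Context {R : realType}.

(** Mean value theorem; continuity up to the endpoints follows from the one-sided
    derivatives there. *)
Lemma constant_velocity (phi : R -> R) (b : R) :
  (forall t, t \in `[0, 1] ->
    h^-1 * (phi (t + h) - phi t)
      @[h --> within [set h : R | t + h \in `[0, 1]] 0^'] --> b) ->
  forall t, t \in `[0, 1] -> phi t = phi 0 + t * b.
Proof.
move=> H.
have D (t eps : R) : t \in `[0, 1] -> 0 < eps ->
    exists2 dl : R, 0 < dl & forall h : R, h != 0 -> `|h| < dl ->
    t + h \in `[0, 1] -> `|b - h^-1 * (phi (t + h) - phi t)| < eps.
  move=> t01 eps0; have /cvgrPdist_lt/(_ _ eps0) := H t t01.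
  move=> /nbhs_ballP[dl /= dl0 hd]; exists dl => // h h0 hdl th.
  by apply: hd => //; rewrite /ball/= sub0r normrN.
have dphi (t : R) : t \in `]0, 1[ -> is_derive t 1 phi b.
  rewrite in_itv/= => /andP[t0 t1].
  have Hd : h^-1 *: ((phi \o shift t) (h *: (1 : R)) - phi t) @[h --> (0 : R)^'] --> b.
    apply/cvgrPdist_lt => eps eps0.
    have t01 : t \in `[0, 1] by rewrite in_itv/= !ltW.
    have [dl dl0 hd] := D t eps t01 eps0.
    near=> h; rewrite /= [h *: 1]mulr1 [h + t]addrC; apply: hd.
    - by near: h; exact: nbhs_dnbhs_neq.
    - by near: h; apply: dnbhs0_lt.
    - have hm : `|h| < Num.min t (1 - t).
        by near: h; apply: dnbhs0_lt; rewrite lt_min t0 subr_gt0.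
      move: hm; rewrite lt_min !ltr_norml => /andP[/andP[h1 _] /andP[_ h2]].
      by rewrite in_itv/=; apply/andP; split; lra.
  by split; [apply/cvg_ex; eexists; exact: Hd|apply/cvg_lim => //; exact: Hd].
have cphi (t eps : R) : t \in `[0, 1] -> 0 < eps ->
    exists2 dl : R, 0 < dl & forall h : R, `|h| < dl ->
    t + h \in `[0, 1] -> `|phi t - phi (t + h)| < eps.
  move=> t01 eps0; have [dl dl0 hd] := D t 1 t01 ltr01.
  have b0 : 0 < `|b| + 1 by rewrite ltr_wpDl.
  exists (Num.min dl (eps / (`|b| + 1))); first by rewrite lt_min dl0 divr_gt0.
  move=> h; rewrite lt_min ltr_pdivlMr// => /andP[h1 h2] th.
  have [->|h0] := eqVneq h 0; first by rewrite addr0 subrr normr0.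
  rewrite distrC -[phi (t + h) - _](mulVKf h0) normrM (le_lt_trans _ h2)//.
  rewrite ler_wpM2l//; have := hd h h0 h1 th; set q := h^-1 * _ => qb.
  rewrite -(subrK b q) (le_trans (ler_normD _ _))// addrC lerD2l.
  by rewrite distrC ltW.
have cw : {within `[0, 1], continuous phi}.
  apply/continuous_within_itvP => //; split.
  - by move=> t /dphi d; exact: is_derive_continuous d.
  - apply/cvgrPdist_lt => eps eps0.
    have [|dl dl0 hd] := cphi 0 eps _ eps0; first by rewrite in_itv/= lexx ler01.
    near=> x; rewrite -[x]add0r; apply: hd.
      rewrite gtr0_norm; first by near: x; apply: nbhs_right_lt.
      by near: x; exact: nbhs_right_gt.
    rewrite add0r in_itv/=; apply/andP; split.
      by apply: ltW; near: x; exact: nbhs_right_gt.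
    by apply: ltW; near: x; exact: nbhs_right_lt.
  - apply/cvgrPdist_lt => eps eps0.
    have [|dl dl0 hd] := cphi 1 eps _ eps0; first by rewrite in_itv/= lexx ler01.
    near=> x; rewrite -[x](subrK 1) [_ + 1]addrC; apply: hd.
      have x1 : x < 1 by near: x; exact: nbhs_left_lt.
      rewrite ltr0_norm ?subr_lt0// opprB ltrBlDr -ltrBlDl.
      by near: x; apply: nbhs_left_gt; rewrite ltrBlDr ltrDl.
    rewrite addrC subrK in_itv/=; apply/andP; split.
      by apply: ltW; near: x; exact: nbhs_left_gt.
    by apply: ltW; near: x; exact: nbhs_left_lt.
move=> t; rewrite in_itv/= => /andP[]; rewrite le_eqVlt => /orP[/eqP <-|t0] t1.
  by rewrite mul0r addr0.
have [c _ e] : exists2 c, c \in `]0, t[%R & phi t - phi 0 = b * (t - 0).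
  apply: (@MVT _ phi (cst b)) => //.
    move=> c; rewrite in_itv/= => /andP[c0 ct]; apply: dphi.
    by rewrite in_itv/= c0 (lt_le_trans ct).
  apply: continuous_subspaceW cw => c /=; rewrite !in_itv/= => /andP[-> ct].
  exact: le_trans ct t1.
by rewrite -(subrK (phi 0) (phi t)) e subr0 addrC mulrC.
Unshelve. all: by end_near. Qed.

End constant_velocity.

Section densities.
Context {R : realType} (n : nat).
Local Notation E := 'rV[R]_n.
Local Notation leb := (@lebesgue_rV R n).

Lemma PhiN (x : E) : Phi (- x) = Phi x.
Proof. by rewrite /Phi enormN. Qed.

Lemma PhiBC (x y : E) : Phi (x - y) = Phi (y - x).
Proof. by rewrite -PhiN opprB. Qed.

Lemma smooth_continuous (f : E -> R) : smooth f -> continuous f.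
Proof. by move=> /(_ 0%N)[]. Qed.

Lemma integrable_density (f : E -> R) : pos_smooth_density f ->
  leb.-integrable setT (EFin \o f).
Proof.
move=> [sf f0 f1]; apply/integrableP; split.
  by apply/measurable_EFinP; exact: (continuous_measurable_rV (smooth_continuous sf)).
rewrite (eq_integral (fun x => (f x)%:E)); first by rewrite f1 ltry.
by move=> x _; rewrite /= gtr0_norm.
Qed.

Lemma density_interpolation (f g : E -> R) (t : R) : t \in `[0, 1] ->
  pos_smooth_density f -> pos_smooth_density g ->
  pos_smooth_density (lin (1 - t) t f g).
Proof.
rewrite in_itv/= => /andP[t0 t1] df dg.
have intf := integrable_density df; have intg := integrable_density dg.
have [sf f0 f1] := df; have [sg g0 g1] := dg; split.
- by move=> k; exact: Ck_lin.
- move=> x; rewrite /lin; have := f0 x; have := g0 x => gx fx.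
  have [->|tn] := eqVneq t 1; first by rewrite subrr mul0r add0r mul1r.
  by rewrite ltr_wpDr ?mulr_ge0 ?(ltW gx)// mulr_gt0// subr_gt0 lt_neqAle tn.
- rewrite /lin; under eq_integral do rewrite EFinD !EFinM.
  rewrite integralD//; [|exact: integrableZl|exact: integrableZl].
  by rewrite !integralZl// f1 g1 !mule1 -EFinD subrK.
Qed.

Lemma tangent_diff (f g : E -> R) : pos_smooth_density f -> pos_smooth_density g ->
  tangent (lin 1 (- 1) f g).
Proof.
move=> df dg.
have intf := integrable_density df; have intg := integrable_density dg.
have [sf f0 f1] := df; have [sg g0 g1] := dg.
have E1 : EFin \o lin 1 (-1) f g = (fun x => (f x)%:E - (g x)%:E)%E.
  by apply/funext => x; rewrite /= /lin mul1r mulN1r EFinB.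
split.
- by move=> k; exact: Ck_lin.
- by rewrite E1; exact: integrableB.
- rewrite -[X in integral _ _ X]/(EFin \o lin 1 (-1) f g) E1 integralB//.
  by rewrite f1 g1 subee.
Qed.

(** A Euclidean ball has positive measure. *)
Lemma ae_witness (P : E -> Prop) (x : E) (r : R) : (0 < n)%N -> 0 < r ->
  {ae leb, forall y, P y} -> exists2 y, enorm (x - y) <= r & P y.
Proof.
move=> n0 r0 [N [mN N0 PN]]; apply: contrapT => h.
have mB : measurable [set y : E | enorm y <= r].
  exact: (measurable_le_rV _ (@enorm_continuous R n)).
have : (leb ((fun y => x - y)%R @^-1` [set y | enorm y <= r]%R) <= leb N)%E.
  apply: le_measure; rewrite ?inE//.
    by rewrite -[X in measurable X]setTI; exact: measurable_reflect.
  move=> y /= yr; apply: PN => /= Py; apply: h; by exists y.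
rewrite lebesgue_rV_reflect// lebesgue_ball// N0 lee_fin leNgt mulr_gt0 ?exprn_gt0//.
exact: unit_ball_volume_gt0.
Qed.

End densities.

(** * Dual geodesics and the divergence *)

Section geodesics.
Context {R : realType} (m : nat).
Let n := m.+1.
Local Notation E := 'rV[R]_n.
Local Notation leb := (@lebesgue_rV R n).
Variables rho nu : E -> R.
Hypothesis rho_density : pos_smooth_density rho.
Hypothesis nu_density : pos_smooth_density nu.
Hypothesis rho_nu_defined : energy_defined rho nu.

Let a : E -> R := lin 1 (- 1) nu rho.

Let aE x : a x = nu x - rho x.
Proof. by rewrite /a /lin mul1r mulN1r. Qed.

Let ta : tangent a. Proof. exact: tangent_diff. Qed.
Let sa : smooth a. Proof. by case: ta. Qed.
Let inta : leb.-integrable setT (EFin \o a). Proof. by case: ta. Qed.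

Let energy_densityE x y : energy_density rho nu x y = Phi (y - x) * a x * a y.
Proof. by rewrite /energy_density PhiBC !aE; ring. Qed.

(** The energy hypothesis makes Phi(y - .) a(.) a(y) integrable for almost every y. Unless
    a = 0, one such y can be chosen with a(y) <> 0, and one point is enough. *)
Lemma energy_Phi_conv_defined : Phi_conv_defined a.
Proof.
have [a0|/existsNP[x1 /eqP ax1]] := pselect (forall x, a x = 0).
  move=> x; apply: (@eq_integrable _ _ _ leb setT measurableT (cst 0%E)) => //;
    last exact: integrable0.
  by move=> y _; rewrite a0 mulr0.
have ca : continuous a := smooth_continuous sa.
have [dl /= dl0 hd] : nbhs_ball x1 [set y | a y != 0].
  apply/nbhs_ballP; have : {for x1, continuous a} by exact: ca.
  by move=> /cvgr_neq0; exact.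
(* Almost every y is good, and the y near x1 have positive measure. *)
have [y yx iy] : exists2 y, enorm (x1 - y) <= dl / 2 &
    leb.-integrable setT (fun x => (energy_density rho nu x y)%:E).
  by apply: ae_witness rho_nu_defined.1 => //; rewrite divr_gt0.
have ay : a y != 0.
  apply: hd; rewrite -ball_normE/= (le_lt_trans (norm_le_enorm _))//.
  by rewrite (le_lt_trans yx)// ltr_pdivrMr// ltr_pMr// ltr1n.
apply: (@Phi_conv_defined_from R m a inta (sa 2) y).
apply: eq_integrable (integrableZl measurableT (a y)^-1 iy) => //.
move=> x _; rewrite -EFinM energy_densityE; congr (_%:E).
by rewrite mulrC mulfK.
Qed.

Let energy : \bar R := (\int[leb]_y \int[leb]_x (energy_density rho nu x y)%:E)%E.

(** Phi is even, and replacing a by - a changes nothing in a quadratic expression. *)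
Lemma metric_energy (sigma : E -> R) : metric sigma a a = energy.
Proof.
apply: eq_integral => y _; rewrite /Phi_conv.
have iy := energy_Phi_conv_defined y.
rewrite EFinM fineK; last exact: integrable_fin_num.
rewrite -integralZl//; apply: eq_integral => x _.
by rewrite -EFinM energy_densityE mulrC.
Qed.

Lemma energy_fin_num : energy \is a fin_num.
Proof. by apply: integrable_fin_num => //; exact: rho_nu_defined.2. Qed.

Lemma integral_linear_weight (c : \bar R) : c \is a fin_num ->
  (\int[lebesgue_measure]_(t in `[0%R, 1%R]) (t%:E * c) = (2^-1)%:E * c)%E.
Proof.
move=> /fineK <-; set r := fine c.
have d (t : R) : 0 <= t <= 1 ->
    is_derive t 1 (fun s => 0 + 0 * (s - 0) + r / 2 * (s - 0) ^+ 2) (t * r).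
  move=> _; have := is_derive_quadratic 0 0 (r / 2) 0 t.
  by congr (is_derive _ _ _ _); field.
transitivity (\int[lebesgue_measure]_(t in `[0%R, 1%R]) (t * r)%:E)%E.
  by apply: eq_integral => t _; rewrite EFinM.
rewrite (FTC2_is_derive ltr01 d) -?EFinB -?EFinM; first by congr (_%:E); field.
apply: continuous_subspaceT => t.
by apply: (@continuousM _ _ (@id R) (cst r)) => //; exact: cst_continuous.
Qed.

(** The Onsager operator does not depend on the base point, so the velocity of a dual
    geodesic is constant in time and the curve is the segment from rho to nu. *)
Lemma dual_geodesic_velocity (gam dgam : R -> E -> R) :
  dual_geodesic gam dgam -> gam 0 = rho -> gam 1 = nu ->
  forall t, t \in `[0, 1] -> dgam t = a.
Proof.
move=> [_ vel _ [_ [f _ dgamE]]] g0 g1.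
have velf x : forall t, t \in `[0, 1] -> gam t x = gam 0 x + t * (- laplacian f x).
  apply: constant_velocity => t t01; have := vel t t01 x.
  by rewrite dgamE.
move=> t t01; apply/funext => x; rewrite dgamE// aE -g0 -g1 (velf x 1).
  by rewrite mul1r addrAC subrr add0r.
by rewrite in_itv/= ler01 lexx.
Qed.

(** The segment from rho to nu is a dual geodesic. What has to be proved is that its
    velocity a satisfies the geodesic equation, that is, a = - Delta (Phi * a). *)
Lemma dual_geodesic_exists : exists gam dgam, [/\ dual_geodesic gam dgam,
  gam 0 = rho & gam 1 = nu].
Proof.
have [Cu Lu] := poisson inta (sa 2) energy_Phi_conv_defined.
exists (fun t => lin (1 - t) t rho nu), (fun=> a); split; last 2 first.
- by apply/funext => x; rewrite /lin subr0 mul1r mul0r addr0.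
- by apply/funext => x; rewrite /lin subrr mul0r mul1r add0r.
split.
- by move=> t t01; exact: density_interpolation.
- move=> t t01 x.
  apply: (@cvg_trans _ (cst (a x) h
    @[h --> within [set h : R | t + h \in `[0, 1]] 0^'])); last exact: cvg_cst.
  apply: near_eq_cvg; apply: cvg_within; near=> h.
  have h0 : h != 0 by near: h; exact: nbhs_dnbhs_neq.
  rewrite /lin /= aE.
  have -> : (1 - (t + h)) * rho x + (t + h) * nu x - ((1 - t) * rho x + t * nu x) =
    h * (nu x - rho x) by ring.
  by rewrite mulKf.
- by move=> t _; exact: ta.
- split; first exact: energy_Phi_conv_defined.
  exists (Phi_conv a); first by split => //; exists 0 => x; rewrite addr0.
  by move=> t _ x; rewrite /onsager Lu.
Unshelve. all: by end_near. Qed.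

(** The infimum is over a single value. *)
Lemma divergenceE : divergence rho nu = ((2^-1)%:E * energy)%E.
Proof.
rewrite /divergence (_ : [set e | _] = [set ((2^-1)%:E * energy)%E]) ?ereal_inf1//.
have cost gam dgam : dual_geodesic gam dgam -> gam 0 = rho -> gam 1 = nu ->
    (\int[lebesgue_measure]_(t in `[0%R, 1%R])
      (t%:E * metric (gam t) (dgam t) (dgam t)) = (2^-1)%:E * energy)%E.
  move=> geo g0 g1; rewrite -integral_linear_weight ?energy_fin_num//.
  apply: eq_integral => t; rewrite inE/= => t01.
  by rewrite (dual_geodesic_velocity geo g0 g1 t01) metric_energy.
apply/seteqP; split => e /=.
  by move=> [gam [dgam [geo g0 g1 ->]]]; exact: cost.
move=> ->; have [gam [dgam [geo g0 g1]]] := dual_geodesic_exists.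
by exists gam, dgam; split => //; rewrite cost.
Qed.

End geodesics.

Theorem theorem4p1 (R : realType) (d : nat) (d_gt0 : (0 < d)%N)
    (rho nu : 'rV[R]_d -> R)
    (rho_density : pos_smooth_density rho)
    (nu_density : pos_smooth_density nu)
    (rho_nu_defined : energy_defined rho nu) :
  divergence rho nu =
  ((2^-1)%:E * \int[@lebesgue_rV R d]_y \int[@lebesgue_rV R d]_x
     (Phi (x - y) * (rho x - nu x) * (rho y - nu y))%:E)%E.
Proof.
case: d d_gt0 rho nu rho_density nu_density rho_nu_defined => // m _ rho nu dr dn def.
exact: divergenceE.
Qed.
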